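(* Let $r\ge 2$ and let $n,q$ be integers with $1\le q\le \frac{n}{100r}$. Then for every graph $G\in\mathcal{T}_{n,r,q}$: (i) $\lambda(G)\ge\lambda(Y_{n,r,q})$, with equality if and only if $G$ is isomorphic to $Y_{n,r,q}$; (ii) $\lambda(G)\le\lambda(L_{n,r,q})$, with equality if and only if $G$ is isomorphic to $L_{n,r,q}$.
   Context: $\lambda(G)$ denotes the spectral radius of the adjacency matrix of $G$. $T_{n,r}$ is the $n$-vertex complete $r$-partite graph with part sizes as equal as possible; $\mathcal{T}_{n,r,q}$ is the family of $n$-vertex graphs obtained from $T_{n,r}$ by adding $q$ edges. $Y_{n,r,q}$ is the graph obtained by adding a matching with $q$ edges into a largest part of $T_{n,r}$. $L_{n,r,q}$ is the graph obtained by embedding a graph $H$ with $q$ edges into a smallest part of $T_{n,r}$, where $H=K_3$ if $q=3$ and $H$ is a star with $q$ edges otherwise. *)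

(* Defs.v *)
From HB Require Import structures.
From mathcomp Require Import all_boot all_order all_algebra.
From mathcomp Require Import complex.
From mathcomp Require Import boolp classical_sets reals.

Set Implicit Arguments.
Unset Strict Implicit.
Unset Printing Implicit Defensive.

Import Order.TTheory GRing.Theory Num.Theory.
Local Open Scope ring_scope.

Record sgraph (V : finType) := SGraph {
  adj :> rel V;
  adj_sym : symmetric adj;
  adj_irr : irreflexive adj
}.

Definition graph_iso (V W : finType) (G : sgraph V) (H : sgraph W) : Prop :=
  exists2 f : V -> W, bijective f & {mono f : x y / adj G x y >-> adj H x y}.

Definition edge_set (V : finType) (G : sgraph V) : {set {set V}} :=
  [set e | [exists x, exists y, G x y && (e == [set x; y])]].

Definition adjacency_matrix (K : pzRingType) (V : finType) (G : sgraph V) :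
    'M[K]_#|V| :=
  \matrix_(i, j) (G (enum_val i) (enum_val j))%:R.

(* The eigenvalues are finitely many, so the supremum is a maximum (and it is
   0 for the empty matrix). *)
Definition spectral_radius (R : realType) (m : nat) (A : 'M[complex R]_m) : R :=
  sup (image [set a | eigenvalue A a]%classic (@Normc.normc R)).

Definition lambda (R : realType) (V : finType) (G : sgraph V) : R :=
  spectral_radius (adjacency_matrix (complex R) G).

Section Turan.
Variables n r : nat.
Implicit Types x y : 'I_n.

(* The parts are the residue classes modulo r. For 0 < r, class i < r consists
   of i, i + r, i + 2r, ... below n, so its size is the ceiling of (n - i) / r:
   the sizes differ by at most one, class 0 is a largest part and class r.-1 is
   a smallest part. *)
Definition turan_rel : rel 'I_n := fun x y => (x %% r != y %% r)%N.

Fact turan_sym : symmetric turan_rel.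
Proof. by move=> x y; rewrite /turan_rel eq_sym. Qed.

Fact turan_irr : irreflexive turan_rel.
Proof. by move=> x; rewrite /turan_rel eqxx. Qed.

Definition turan : sgraph 'I_n := SGraph turan_sym turan_irr.

(* T_{n,r} with H added inside the part of residue i: vertex a of H is placed
   at a * r + i, the element of that part with quotient a modulo r. All of H is
   embedded exactly when i < r and the part has at least m vertices. *)
Definition turan_embed_rel (i m : nat) (H : sgraph 'I_m) : rel 'I_n :=
  fun x y => turan x y ||
    [&& x %% r == i, y %% r == i &
        [exists a, exists b, [&& H a b, a == x %/ r :> nat & b == y %/ r :> nat]]]%N.

Fact turan_embed_sym i m (H : sgraph 'I_m) : symmetric (turan_embed_rel i H).
Proof.
move=> x y; rewrite /turan_embed_rel adj_sym andbCA; congr (_ || (_ && (_ && _))).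
by apply/existsP/existsP => -[a /existsP[b /and3P[Hab xa yb]]];
  exists b; apply/existsP; exists a; rewrite adj_sym Hab xa yb.
Qed.

Fact turan_embed_irr i m (H : sgraph 'I_m) : irreflexive (turan_embed_rel i H).
Proof.
move=> x; rewrite /turan_embed_rel adj_irr /=; apply/negP => /and3P[_ _].
case/existsP=> a /existsP[b /and3P[Hab /eqP xa /eqP xb]].
have ab : a = b by apply: val_inj; rewrite /= xa xb.
by rewrite ab adj_irr in Hab.
Qed.

Definition turan_embed i m (H : sgraph 'I_m) : sgraph 'I_n :=
  SGraph (turan_embed_sym i H) (turan_embed_irr i H).

(* Up to isomorphism, G contains T_{n,r} as a spanning subgraph and has exactly
   q further edges. *)
Definition turan_plus_edges (q : nat) (V : finType) (G : sgraph V) : Prop :=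
  exists f : 'I_n -> V,
    [/\ bijective f,
        forall x y, turan x y -> G (f x) (f y)
      & #|edge_set G| = (#|edge_set turan| + q)%N].

End Turan.

Definition matching_rel (q : nat) : rel 'I_q.*2 :=
  fun a b => (a != b) && (a./2 == b./2).

Fact matching_sym q : symmetric (@matching_rel q).
Proof. by move=> a b; rewrite /matching_rel eq_sym [_./2 == _]eq_sym. Qed.

Fact matching_irr q : irreflexive (@matching_rel q).
Proof. by move=> a; rewrite /matching_rel eqxx. Qed.

Definition matching_graph q : sgraph 'I_q.*2 :=
  SGraph (@matching_sym q) (@matching_irr q).

(* The centre is vertex 0. *)
Definition star_rel (q : nat) : rel 'I_q.+1 :=
  fun a b => (a == ord0) != (b == ord0).

Fact star_sym q : symmetric (@star_rel q).
Proof. by move=> a b; rewrite /star_rel eq_sym. Qed.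

Fact star_irr q : irreflexive (@star_rel q).
Proof. by move=> a; rewrite /star_rel eqxx. Qed.

Definition star_graph q : sgraph 'I_q.+1 := SGraph (@star_sym q) (@star_irr q).

Definition complete_rel (m : nat) : rel 'I_m := fun a b => a != b.

Fact complete_sym m : symmetric (@complete_rel m).
Proof. by move=> a b; rewrite /complete_rel eq_sym. Qed.

Fact complete_irr m : irreflexive (@complete_rel m).
Proof. by move=> a; rewrite /complete_rel eqxx. Qed.

Definition complete_graph m : sgraph 'I_m :=
  SGraph (@complete_sym m) (@complete_irr m).

Definition Y_graph (n r q : nat) : sgraph 'I_n :=
  turan_embed n r 0 (matching_graph q).

Definition L_graph (n r q : nat) : sgraph 'I_n :=
  if q == 3%N then turan_embed n r r.-1 (complete_graph 3)
  else turan_embed n r r.-1 (star_graph q).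

(* Main.v *)
(** Let [H] consist of the edges of [G] inside the parts, let [mu] be a real
    number exceeding its degrees, put [y = (mu - A_H)^-1 1], and let [W_i] be
    the sum of [y] over the i-th part.  The test vector [y v / (1 + W_i)] shows
    that [mu] lies below, at or above [lambda G] according to whether the sum of
    [W_i / (1 + W_i)] is above, at or below 1.  So two graphs containing the
    Turán graph are compared by comparing these sums at [mu = lambda G], which
    is at least [99 q].

    Here [W_i = n_i / mu + X_i], where [X_i] generates the walks of [H] in the
    part, and [w |-> w / (1 + w)] is increasing and strictly concave.  The
    total of the [X_i] is at least [2 q / (mu (mu - 1))], with equality for
    matchings only, and by concavity it has the least effect when concentrated
    in one largest part: this gives (i).  For (ii), the third-order coefficient
    of the total is the number of 2-walks, which falls short of its value for a
    star by twice the number of pairs of disjoint edges; since [q] is small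
    against [mu], this deficit dominates all later terms and the concavity
    correction.  If all edges of [H] meet pairwise then [H] is a star or a
    triangle, and a smallest part is the best place for it. *)

From HB Require Import structures.
Require Import Defs.
From mathcomp Require Import all_boot all_order all_algebra.
From mathcomp Require Import perm complex spectral.
From mathcomp Require Import boolp classical_sets reals.
From mathcomp Require Import zify ring lra.

Set Implicit Arguments.
Unset Strict Implicit.
Unset Printing Implicit Defensive.

Import Order.TTheory GRing.Theory Num.Theory.
Local Open Scope ring_scope.

(** * Spectral radius *)

(** A normal matrix is unitarily diagonalisable, and in an eigenbasis the quadratic form is the sum
    of the [|z_i|^2] weighted by the eigenvalues. *)
Lemma normal_rayleigh_le (C : numClosedFieldType) (m : nat) (A : 'M[C]_m)
    (b : C) (v : 'rV[C]_m) :
  A \is normalmx -> (forall a, eigenvalue A a -> `|a| <= b) ->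
  `|(v *m A *m map_mx Num.conj v^T) 0 0| <= b * (v *m map_mx Num.conj v^T) 0 0.
Proof.
move=> /orthomx_spectralP[defA] hb.
set P := spectralmx A in defA; set D := spectral_diag A in defA.
have Pu : P \is unitarymx by exact: spectral_unitarymx.
have Punit := unitarymx_unit Pu.
have eigD i : eigenvalue A (D 0 i).
  apply/eigenvalueP; exists (row i P).
    rewrite -row_mul {1}defA !mulmxA mulmxV // mul1mx row_mul row_diag_mx.
    by rewrite -scalemxAl -rowE.
  (* A row of [P] is a genuine eigenvector: a zero row would contradict the invertibility of [P]. *)
  apply/negP => /eqP ri0; have := oner_neq0 C.
  have /matrixP/(_ i i) : P *m invmx P = 1%:M by exact: mulmxV.
  rewrite !mxE eqxx big1 => [e0|j _]; first by rewrite -[1]mulr1n -e0 eqxx.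
  by have /rowP/(_ j) := ri0; rewrite !mxE => ->; rewrite mul0r.
pose z := v *m map_mx Num.conj P^T.
have vE : v = z *m P by rewrite /z mulmxKtV.
have zz (w : 'rV[C]_m) : (w *m map_mx Num.conj z^T) 0 0 = \sum_i w 0 i * (z 0 i)^*.
  by rewrite mxE; apply: eq_bigr => i _; rewrite !mxE.
have vstar : map_mx Num.conj v^T = map_mx Num.conj P^T *m map_mx Num.conj z^T.
  by rewrite {1}vE trmx_mul map_mxM.
have -> : v *m map_mx Num.conj v^T = z *m map_mx Num.conj z^T.
  by rewrite vstar mulmxA.
have -> : v *m A *m map_mx Num.conj v^T = z *m diag_mx D *m map_mx Num.conj z^T.
  by rewrite vstar {1}vE {1}defA !mulmxA mulmxK // -invmx_unitary // mulmxK.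
rewrite !zz mulr_sumr; apply: le_trans (ler_norm_sum _ _ _) _.
apply: ler_sum => i _; rewrite mul_mx_diag mxE -mulrA mulrCA normrM.
by rewrite -normCK normrX normr_id ler_wpM2r ?exprn_ge0 // hb.
Qed.

Section Lambda.
Variables (R : realType) (V : finType) (G : sgraph V).
Local Notation C := (complex R).
Local Notation A := (adjacency_matrix C G).
Implicit Types (x : V -> R) (mu : R).

Lemma normC_normc (z : C) : `|z| = (Normc.normc z)%:C%C.
Proof. by case: z. Qed.

(** This and the converse below replace row vectors by functions on the vertices; row and column
    eigenvectors agree because the matrix is symmetric. *)
Lemma adjacency_eigenfun (a : C) : eigenvalue A a ->
  exists2 z : V -> C, exists u, z u != 0 & forall v, \sum_(u | G v u) z u = a * z v.
Proof.
case/eigenvalueP=> w wA w0.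
exists (fun u => w 0 (enum_rank u)).
  apply/existsP; apply: contraR w0; rewrite negb_exists => /forallP h.
  apply/eqP/rowP => i; rewrite mxE; have := h (enum_val i).
  by rewrite enum_valK negbK => /eqP.
move=> v; have /rowP/(_ (enum_rank v)) := wA; rewrite !mxE => <-.
rewrite [LHS](reindex (@enum_val V xpredT)) /=; last first.
  by apply: onW_bij; exact: enum_val_bij.
rewrite [LHS]big_mkcond; apply: eq_bigr => i _; rewrite !mxE enum_rankK enum_valK.
by rewrite adj_sym; case: (G _ _); rewrite ?mulr1 ?mulr0.
Qed.

Lemma eigenfun_adjacency (a : C) (z : V -> C) (u0 : V) : z u0 != 0 ->
  (forall v, \sum_(u | G v u) z u = a * z v) -> eigenvalue A a.
Proof.
move=> z0 hz; apply/eigenvalueP; exists (\row_i z (enum_val i)).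
  apply/rowP => j; rewrite !mxE -hz.
  rewrite [RHS](reindex (@enum_val V xpredT)) /=; last first.
    by apply: onW_bij; exact: enum_val_bij.
  rewrite [RHS]big_mkcond.
  by apply: eq_bigr => i _; rewrite !mxE adj_sym; case: (G _ _); rewrite ?mulr1 ?mulr0.
apply/negP => /eqP/rowP/(_ (enum_rank u0)); rewrite !mxE enum_rankK => e.
by rewrite e eqxx in z0.
Qed.

(* At a vertex maximising |z v| / x v the eigenvalue equation gives |a| <= mu. *)
Lemma normc_eigenvalue_le x mu : (forall v, 0 < x v) ->
  (forall v, \sum_(u | G v u) x u <= mu * x v) ->
  forall a, eigenvalue A a -> Normc.normc a <= mu.
Proof.
move=> x0 hx a /adjacency_eigenfun[z [u0 zu0] hz].
pose N u := Normc.normc (z u).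
have N0 u : 0 <= N u by rewrite -lecR -normC_normc; exact: normr_ge0.
have [v _ vmax] := arg_maxP (i0 := u0) (P := xpredT) (fun u => N u / x u) isT.
set m := N v / x v in vmax.
have Nm u : N u <= m * x u by rewrite -ler_pdivrMr //; exact: vmax.
have Nv : N v = m * x v by rewrite /m mulfVK // gt_eqF.
have Nv0 : 0 < N v.
  have : 0 < m * x u0.
    apply: lt_le_trans (Nm u0); rewrite lt_neqAle N0 andbT eq_sym.
    by apply: contra zu0 => /eqP /Normc.eq0_normc ->.
  by rewrite pmulr_lgt0 // Nv => m0; rewrite mulr_gt0.
rewrite -(ler_pM2r Nv0) {1}/N -Normc.normcM -hz.
have m0 : 0 <= m by rewrite divr_ge0 // ltW.
rewrite Nv mulrCA; apply: le_trans (ler_wpM2l m0 (hx v)).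
rewrite mulr_sumr; apply: le_trans (ler_sum _ (fun u _ => Nm u)).
rewrite -lecR -normC_normc; apply: le_trans (ler_norm_sum _ _ _) _.
rewrite raddf_sum /=; apply: ler_sum => u _.
by rewrite normC_normc.
Qed.

Lemma lambda_le x mu : (forall v, 0 < x v) -> 0 <= mu ->
  (forall v, \sum_(u | G v u) x u <= mu * x v) -> lambda R G <= mu.
Proof.
move=> x0 mu0 hx; rewrite /lambda /spectral_radius.
(* An empty spectrum has supremum 0 by convention, and [0 <= mu] covers this case. *)
set S := (S in sup S); have [S0|] := eqVneq S set0; first by rewrite S0 sup0.
move=> /set0P S0; apply: ge_sup => // _ [a ha <-].
exact: normc_eigenvalue_le x0 hx _ ha.
Qed.

Lemma normc_eigenvalue_le_lambda a : eigenvalue A a -> Normc.normc a <= lambda R G.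
Proof.
move=> ha; apply: ub_le_sup; last by exists a.
(* The supremum needs a bound on the spectrum: no degree exceeds [#|V|], so the constant test
   function gives one. *)
exists #|V|%:R => _ [b hb <-].
apply: (@normc_eigenvalue_le (fun=> 1)) hb => // v.
rewrite mulr1 sumr_const ler_nat; exact: max_card.
Qed.

(** Pairing the hypothesis with the positive function [x] bounds its Rayleigh quotient below by
    [mu]; the quotient is at most the spectral radius because the real symmetric matrix is normal.
    The vertex [v0] makes the norm of [x] positive. *)
Lemma lambda_ge x mu (v0 : V) : (forall v, 0 < x v) ->
  (forall v, mu * x v <= \sum_(u | G v u) x u) -> mu <= lambda R G.
Proof.
move=> x0 hx.
pose w : 'rV[C]_#|V| := \row_i (x (enum_val i))%:C%C.
have wstar i : (map_mx Num.conj w^T) i 0 = w 0 i.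
  by rewrite !mxE; apply: CrealP; rewrite complex_real.
have hn : A \is normalmx.
  apply: symmetric_normalmx.
    by rewrite is_hermitianmxE expr0 scale1r; apply/eqP/matrixP => i j;
      rewrite !mxE adj_sym.
  by apply/mxOverP => i j; rewrite mxE realn.
have := @normal_rayleigh_le _ _ A ((lambda R G)%:C)%C w hn.
have hb (a : C) : eigenvalue A a -> `|a| <= (lambda R G)%:C%C.
  by move=> ha; rewrite normC_normc lecR normc_eigenvalue_le_lambda.
move=> /(_ hb).
have enumE (F : V -> R) : \sum_v F v = \sum_(i < #|V|) F (enum_val i).
  by rewrite [LHS](reindex (@enum_val V xpredT)) //; apply: onW_bij; exact: enum_val_bij.
have -> : (w *m map_mx Num.conj w^T) 0 0 = (\sum_v x v ^+ 2)%:C%C.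
  rewrite mxE enumE rmorph_sum; apply: eq_bigr => i _.
  by rewrite wstar !mxE rmorphXn expr2.
have -> : (w *m A *m map_mx Num.conj w^T) 0 0 =
    (\sum_v (\sum_(u | G v u) x u) * x v)%:C%C.
  rewrite mxE enumE rmorph_sum; apply: eq_bigr => j _.
  rewrite wstar !mxE rmorphM; congr (_ * _).
  rewrite [in RHS]big_mkcond enumE rmorph_sum; apply: eq_bigr => i _.
  by rewrite !mxE adj_sym; case: (G _ _); rewrite ?mulr1 ?mulr0.
rewrite normC_normc -rmorphM lecR => h.
have T0 : 0 < \sum_v x v ^+ 2.
  rewrite (bigD1 v0) //=; apply: ltr_pwDl; first by rewrite exprn_gt0.
  by apply: sumr_ge0 => u _; rewrite sqr_ge0.
rewrite -(ler_pM2r T0); apply: le_trans h.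
have -> (a : R) : Normc.normc a%:C%C = `|a|.
  by rewrite /Normc.normc /= expr0n addr0 sqrtr_sqr.
apply: le_trans (ler_norm _); rewrite mulr_sumr; apply: ler_sum => v _.
by rewrite expr2 mulrA ler_wpM2r // ltW.
Qed.
End Lambda.

(** * Resolvent of a graph *)

Lemma graph_iso_sym (V W : finType) (G : sgraph V) (H : sgraph W) :
  graph_iso G H -> graph_iso H G.
Proof.
case=> f [g fg gf] fm; exists g; first by exists f.
by move=> x y; rewrite -fm !gf.
Qed.

Lemma graph_iso_trans (U V W : finType) (G : sgraph U) (H : sgraph V)
    (K : sgraph W) : graph_iso G H -> graph_iso H K -> graph_iso G K.
Proof.
case=> f bf fm [g bg gm]; exists (g \o f); first exact: bij_comp.
by move=> x y /=; rewrite gm fm.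
Qed.

Lemma eigenvalue_graph_iso (R : realType) (V W : finType) (G : sgraph V)
    (H : sgraph W) (a : complex R) : graph_iso G H ->
  eigenvalue (adjacency_matrix (complex R) G) a ->
  eigenvalue (adjacency_matrix (complex R) H) a.
Proof.
case=> f [g fg gf] fm /adjacency_eigenfun[z [u zu] hz].
apply: (@eigenfun_adjacency _ _ _ _ (z \o g) (f u)); first by rewrite /= fg.
move=> v; rewrite (reindex f) /=; last by exists g => x _.
rewrite -hz; apply: eq_big => [x|x _]; last by rewrite fg.
by rewrite -{1}(gf v) fm.
Qed.

Lemma lambda_graph_iso (R : realType) (V W : finType) (G : sgraph V)
    (H : sgraph W) : graph_iso G H -> lambda R G = lambda R H.
Proof.
move=> GH; rewrite /lambda /spectral_radius; congr (sup (_ @` _))%classic.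
apply/seteqP; split=> a /=; apply: eigenvalue_graph_iso => //.
exact: graph_iso_sym.
Qed.

Lemma sum_adj_exchange (R : nmodType) (V : finType) (H : sgraph V)
    (F : V -> V -> R) :
  \sum_v \sum_(u | H v u) F v u = \sum_u \sum_(v | H u v) F v u.
Proof.
rewrite (exchange_big_dep xpredT) //=; apply: eq_bigr => u _.
by apply: eq_bigl => v /=; rewrite [LHS]adj_sym.
Qed.

Section Resolvent.
Variables (R : realFieldType) (V : finType) (H : sgraph V) (mu : R).
Implicit Types (y z c : V -> R).

(** This makes [mu - A] strictly diagonally dominant, hence invertible. *)
Definition max_degree_lt := forall v, #|H v|%:R < mu.

Definition resolvent (v : V) : R :=
  (const_mx 1 *m invmx (mu%:M - adjacency_matrix R H) : 'rV_#|V|) 0 (enum_rank v).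

Hypothesis degH : max_degree_lt.

Lemma max_degree_lt_gt0 (v : V) : 0 < mu.
Proof. by apply: le_lt_trans (degH v); rewrite ler0n. Qed.

(** Maximum principle: where [|z v|] is largest, [mu * |z v|] is at most the degree times [|z v|],
    and the degree is below [mu]. *)
Lemma resolvent_kernel z :
  (forall v, mu * z v = \sum_(u | H v u) z u) -> forall v, z v = 0.
Proof.
move=> hz w.
have [v _ vmax] := arg_maxP (i0 := w) (P := xpredT) (fun u => `|z u|) isT.
suff v0 : `|z v| <= 0.
  by apply/eqP; rewrite -normr_le0; apply: le_trans v0; exact: vmax.
have mu0 := max_degree_lt_gt0 v.
have : mu * `|z v| <= #|H v|%:R * `|z v|.
  rewrite -[X in X * _](gtr0_norm mu0) -normrM hz; apply: le_trans (ler_norm_sum _ _ _) _.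
  rewrite mulr_natl -sumr_const; apply: ler_sum => u _; exact: vmax.
by rewrite -subr_le0 -mulrBl pmulr_rle0 // subr_gt0.
Qed.

Lemma resolvent_unit : mu%:M - adjacency_matrix R H \in unitmx.
Proof.
rewrite -row_free_unit; apply: inj_row_free => w hw.
apply/rowP => i; rewrite mxE -(enum_valK i).
apply: (@resolvent_kernel (fun u => w 0 (enum_rank u))) => v.
have /rowP/(_ (enum_rank v)) := hw; rewrite mulmxBr mul_mx_scalar !mxE.
move=> /eqP; rewrite subr_eq0 => /eqP ->.
rewrite [RHS](reindex (@enum_val V xpredT)) /=; last first.
  by apply: onW_bij; exact: enum_val_bij.
rewrite [RHS]big_mkcond; apply: eq_bigr => j _; rewrite !mxE enum_rankK enum_valK.
by rewrite adj_sym; case: (H _ _); rewrite ?mulr1 ?mulr0.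
Qed.

Lemma resolventE v : mu * resolvent v = 1 + \sum_(u | H v u) resolvent u.
Proof.
apply/eqP; rewrite -subr_eq; apply/eqP.
set w := (const_mx 1 *m invmx (mu%:M - adjacency_matrix R H) : 'rV_#|V|).
have : w *m (mu%:M - adjacency_matrix R H) = const_mx 1.
  by rewrite /w mulmxKV // resolvent_unit.
rewrite /resolvent -/w; move: w => w.
move/rowP/(_ (enum_rank v)); rewrite mulmxBr mul_mx_scalar !mxE => <-.
congr (_ - _).
rewrite [LHS](reindex (@enum_val V xpredT)) /=; last first.
  by apply: onW_bij; exact: enum_val_bij.
rewrite [LHS]big_mkcond; apply: eq_bigr => j _; rewrite !mxE enum_rankK enum_valK.
by rewrite adj_sym; case: (H _ _); rewrite ?mulr1 ?mulr0.
Qed.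

Lemma resolvent_unique z :
  (forall v, mu * z v = 1 + \sum_(u | H v u) z u) -> z =1 resolvent.
Proof.
move=> hz v; apply/eqP; rewrite -subr_eq0; apply/eqP.
apply: (@resolvent_kernel (fun v => z v - resolvent v)) => {}v.
by rewrite mulrBr hz resolventE opprD addrACA subrr add0r sumrB.
Qed.

(** Minimum principle: at a vertex of least value, the resolvent equation makes [mu] minus the
    degree, times that value, at least 1. *)
Lemma resolvent_gt0 w : 0 < resolvent w.
Proof.
have [v _ vmin] := arg_minP (i0 := w) (P := xpredT) resolvent isT.
suff v0 : 0 < resolvent v by apply: lt_le_trans v0 _; exact: vmin.
have : 1 + #|H v|%:R * resolvent v <= mu * resolvent v.
  rewrite resolventE lerD2l mulr_natl -sumr_const; apply: ler_sum => u _.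
  exact: vmin.
rewrite -lerBrDr -mulrBl => h; have : 0 < (mu - #|H v|%:R) * resolvent v.
  exact: lt_le_trans h.
by rewrite pmulr_rgt0 // subr_gt0.
Qed.

Lemma resolvent_ge v : mu^-1 <= resolvent v.
Proof.
have mu0 := max_degree_lt_gt0 v.
rewrite -(ler_pM2l mu0) mulfV ?gt_eqF // resolventE lerDl.
by apply: sumr_ge0 => u _; exact/ltW/resolvent_gt0.
Qed.

(** The minimum principle applies to the nonisolated vertices alone, since every neighbour of such a
    vertex is again nonisolated; the degree there is at least 1. *)
Lemma resolvent_ge_nonisolated w : 1 < mu -> (0 < #|H w|)%N ->
  (mu - 1)^-1 <= resolvent w.
Proof.
move=> mu1 dw.
have [v dv vmin] := arg_minP (P := fun v => (0 < #|H v|)%N) resolvent dw.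
apply: le_trans (vmin _ dw).
rewrite -[leLHS]mul1r ler_pdivrMr ?subr_gt0 //.
have h : forall u, H v u -> resolvent v <= resolvent u.
  by move=> u vu; apply: vmin; apply/card_gt0P; exists v; rewrite -[_ \in _]/(H u v) adj_sym.
have : 1 + #|H v|%:R * resolvent v <= mu * resolvent v.
  rewrite resolventE lerD2l mulr_natl -sumr_const; apply: ler_sum => u; exact: h.
have : 1 * resolvent v <= #|H v|%:R * resolvent v.
  by rewrite ler_wpM2r ?ler1n // ltW // resolvent_gt0.
by move: (resolvent v) (#|H v|%:R) => a b; lra.
Qed.

Lemma resolvent_le (b : R) w : (forall v, #|H v|%:R <= b) -> b < mu ->
  resolvent w <= (mu - b)^-1.
Proof.
move=> hb bmu.
have [v _ vmax] := arg_maxP (i0 := w) (P := xpredT) resolvent isT.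
have wv : resolvent w <= resolvent v by exact: vmax.
apply: (le_trans wv); rewrite -[leRHS]mul1r ler_pdivlMr ?subr_gt0 //.
have : mu * resolvent v <= 1 + #|H v|%:R * resolvent v.
  rewrite resolventE lerD2l mulr_natl -sumr_const; apply: ler_sum => u _.
  exact: vmax.
have : #|H v|%:R * resolvent v <= b * resolvent v.
  by rewrite ler_wpM2r // ltW // resolvent_gt0.
by move: (resolvent v) (#|H v|%:R) => a c; lra.
Qed.

(** One step of the walk expansion: the weight [c] is replaced by its image under the adjacency
    operator at the cost of a factor [mu]. *)
Lemma sum_resolvent c : mu * (\sum_v c v * resolvent v) =
  \sum_v c v + \sum_v (\sum_(u | H v u) c u) * resolvent v.
Proof.
rewrite mulr_sumr; transitivity
  (\sum_v c v + \sum_v \sum_(u | H v u) c v * resolvent u).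
  rewrite -big_split; apply: eq_bigr => v _ /=.
  by rewrite mulrCA resolventE mulrDr mulr1 mulr_sumr.
congr (_ + _); rewrite sum_adj_exchange; apply: eq_bigr => v _.
by rewrite mulr_suml.
Qed.

(** As a series, this is the sum over [k >= 1] of the number of walks with [k] edges starting in
    [P], divided by [mu ^ k.+1]. *)
Definition excess (P : pred V) : R := \sum_(v | P v) (resolvent v - mu^-1).

Lemma excess_ge0 P : 0 <= excess P.
Proof. by apply: sumr_ge0 => v _; rewrite subr_ge0 resolvent_ge. Qed.

Lemma resolvent_excess v :
  resolvent v - mu^-1 = mu^-1 * \sum_(u | H v u) resolvent u.
Proof.
have mu0 := max_degree_lt_gt0 v.
apply: (mulfI (lt0r_neq0 mu0)); rewrite mulrBr mulrA mulfV ?gt_eqF //.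
by rewrite resolventE mul1r addrC addKr.
Qed.

Lemma excess_adj P : excess P = mu^-1 * \sum_(v | P v) \sum_(u | H v u) resolvent u.
Proof. by rewrite mulr_sumr; apply: eq_bigr => v _; exact: resolvent_excess. Qed.

Lemma excessT : excess xpredT = mu^-1 * \sum_v #|H v|%:R * resolvent v.
Proof.
rewrite excess_adj sum_adj_exchange; congr (_ * _); apply: eq_bigr => v _.
by rewrite sumr_const mulr_natl.
Qed.

Lemma excess_eq0 P (x y : V) : excess P = 0 -> P x -> H x y -> False.
Proof.
move=> /eqP; rewrite excess_adj mulf_eq0 invr_eq0.
rewrite (gt_eqF (max_degree_lt_gt0 x)) /=; set S := \sum_(v | _) _ => S0 Px xy.
have : 0 < S.
  rewrite /S (bigD1 x) //= (bigD1 y) //= -addrA; apply: ltr_pwDl.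
    exact: resolvent_gt0.
  by apply: addr_ge0; do ?[apply: sumr_ge0 => ? _]; exact/ltW/resolvent_gt0.
by rewrite (eqP S0) ltxx.
Qed.

(** Two steps of the walk expansion starting from the degrees. The three numerators count the walks
    with one, two and three edges; the remainder is controlled by the bound [(mu - b)^-1] on the
    resolvent. *)
Lemma excess_le (b : R) : (forall v, #|H v|%:R <= b) -> 0 <= b < mu ->
  excess xpredT <= (\sum_v #|H v|%:R) / mu ^+ 2 + (\sum_v #|H v|%:R ^+ 2) / mu ^+ 3
   + (\sum_v \sum_(u | H v u) #|H v|%:R * #|H u|%:R) / (mu ^+ 3 * (mu - b)).
Proof.
move=> hb /andP[b0 bmu]; have mu0 : 0 < mu by exact: le_lt_trans b0 bmu.
have muN0 := lt0r_neq0 mu0.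
set m1 := \sum_v _; set m2 := \sum_v #|H v|%:R ^+ 2; set m3 := \sum_v \sum_(u | _) _.
pose d1 (v : V) : R := #|H v|%:R.
pose d2 v := \sum_(u | H v u) d1 u; pose d3 v := \sum_(u | H v u) d2 u.
have E1 : mu * (\sum_v d1 v * resolvent v) = m1 + \sum_v d2 v * resolvent v.
  exact: sum_resolvent.
have E2 : mu * (\sum_v d2 v * resolvent v) =
    \sum_v d2 v + \sum_v d3 v * resolvent v by exact: sum_resolvent.
have M2 : \sum_v d2 v = m2.
  rewrite /d2 sum_adj_exchange; apply: eq_bigr => v _.
  by rewrite sumr_const expr2 mulr_natl.
have M3 : \sum_v d3 v = m3.
  rewrite /d3 sum_adj_exchange; apply: eq_bigr => v _.
  by rewrite sumr_const -[_ *+ _]mulr_natl mulr_sumr.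
have d3le : \sum_v d3 v * resolvent v <= m3 / (mu - b).
  rewrite -M3 mulr_suml; apply: ler_sum => v _.
  apply: ler_wpM2l; last exact: resolvent_le.
  by do 2!(apply: sumr_ge0 => ? _).
rewrite excessT.
have -> : mu^-1 * (\sum_v d1 v * resolvent v) =
   m1 / mu ^+ 2 + m2 / mu ^+ 3 + (\sum_v d3 v * resolvent v) / mu ^+ 3.
  apply: (mulfI (expf_neq0 3 muN0)).
  set S := \sum_v d1 v * _ in E1 *; set S2 := \sum_v d2 v * _ in E1 E2.
  set S3 := \sum_v d3 v * _ in E2 *.
  have -> : mu ^+ 3 * (mu^-1 * S) = mu * (mu * S) by field.
  by rewrite E1 mulrDr E2 M2; field.
rewrite lerD2l [mu ^+ 3 * (mu - b)]mulrC [((mu - b) * _)^-1]invfM mulrA ler_wpM2r //.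
by rewrite invr_ge0 exprn_ge0 // ltW.
Qed.

(** Isolated vertices have weight 0 in the degree sum, and at all others the resolvent is at least
    [(mu - 1)^-1]. *)
Lemma excess_ge : 1 < mu ->
  (\sum_v #|H v|%:R) / (mu * (mu - 1)) <= excess xpredT.
Proof.
move=> mu1; rewrite excessT invfM mulrA [_ / mu]mulrC -mulrA.
rewrite ler_wpM2l ?invr_ge0 ?(ltW (lt_trans ltr01 mu1)) // mulr_suml.
apply: ler_sum => v _; have [->|] := posnP #|H v|; first by rewrite !mul0r.
by move=> dv; rewrite ler_wpM2l //; exact: resolvent_ge_nonisolated.
Qed.

(* Equality forces resolvent = 1 / (mu - 1) at every nonisolated vertex. *)
Lemma excess_eq_degree_le1 : 1 < mu ->
  excess xpredT = (\sum_v #|H v|%:R) / (mu * (mu - 1)) -> forall v, (#|H v| <= 1)%N.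
Proof.
move=> mu1; rewrite excessT invfM mulrA [_ / mu]mulrC -mulrA.
have mu0 := lt_trans ltr01 mu1; have m10 : mu - 1 != 0 by rewrite gt_eqF ?subr_gt0.
move/(mulfI (invr_neq0 (lt0r_neq0 mu0))); rewrite mulr_suml => /eqP.
rewrite -subr_eq0 -sumrB psumr_eq0; last first.
  move=> v _; rewrite -mulrBr; have [->|dv] := posnP #|H v|; first by rewrite mul0r.
  by rewrite mulr_ge0 // subr_ge0; exact: resolvent_ge_nonisolated.
move=> /allP h.
have yE v : (0 < #|H v|)%N -> resolvent v = (mu - 1)^-1.
  move=> dv; have := h v (mem_index_enum v); rewrite /= -mulrBr mulf_eq0 pnatr_eq0.
  by rewrite eqn0Ngt dv /= subr_eq0 => /eqP.
move=> v; rewrite leqNgt; apply/negP => dv.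
have := resolventE v; rewrite yE ?(ltn_trans _ dv) //.
rewrite (eq_bigr (fun=> (mu - 1)^-1)); last first.
  by move=> u vu; apply: yE; apply/card_gt0P; exists v; rewrite -[_ \in _]/(H u v) adj_sym.
rewrite sumr_const -mulr_natl => /(congr1 ( *%R^~ (mu - 1))).
rewrite mulrDl !mulfVK // mul1r => e.
have : (1 < #|H v|%:R :> R) by rewrite ltr1n.
lra.
Qed.

End Resolvent.

(** Since the edge condition is an equality, [H] is a copy of [H0] together with isolated
    vertices. *)
Definition embeds (W V : finType) (H0 : sgraph W) (H : sgraph V) (h : W -> V) :=
  injective h /\
  forall x y, H x y = [exists a, exists b, [&& H0 a b, h a == x & h b == y]].

(** * Invariance of resolvent and excess under adding isolated vertices *)

Section Embedding.
Variables (W V : finType) (H0 : sgraph W) (H : sgraph V) (h : W -> V).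
Hypothesis Hh : embeds H0 H h.

Lemma embeds_adj a b : H (h a) (h b) = H0 a b.
Proof.
case: Hh => hI ->; apply/existsP/idP => [[c /existsP[d /and3P[cd /eqP/hI <- /eqP/hI <-]]]|ab] //.
by exists a; apply/existsP; exists b; rewrite ab !eqxx.
Qed.

Lemma embeds_codom x y : H x y -> exists a, x = h a.
Proof.
by case: Hh => _ -> /existsP[a /existsP[b /and3P[_ /eqP <- _]]]; exists a.
Qed.

Lemma embeds_sum (R : nmodType) (F : V -> R) a :
  \sum_(u | H (h a) u) F u = \sum_(b | H0 a b) F (h b).
Proof.
have [hI _] := Hh.
rewrite -(big_imset F (A := H0 a) (h := h)) /=; last by move=> ? ? _ _; exact: hI.
apply: eq_bigl => u; apply/idP/imsetP => [au|[b ab ->]]; last by rewrite embeds_adj.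
have [b ub] : exists b, u = h b by apply: (@embeds_codom _ (h a)); rewrite adj_sym.
by exists b => //; rewrite -[_ \in _]/(H0 a b) -embeds_adj -ub.
Qed.

Lemma embeds_degree a : #|H (h a)| = #|H0 a|.
Proof. by rewrite -!sum1_card; exact: (embeds_sum (fun=> 1%N)). Qed.

Variables (R : realFieldType) (mu : R).
Hypothesis degH : max_degree_lt H mu.

Lemma embeds_max_degree_lt : max_degree_lt H0 mu.
Proof. by move=> a; rewrite -embeds_degree. Qed.

Lemma embeds_resolvent a : resolvent H mu (h a) = resolvent H0 mu a.
Proof.
apply: (resolvent_unique embeds_max_degree_lt (z := resolvent H mu \o h)) => {}a /=.
by rewrite (resolventE degH) embeds_sum.
Qed.

(** Vertices outside the copy are isolated, so their resolvent is [mu^-1] and they contribute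
    nothing. *)
Lemma embeds_excess (P : pred V) : (forall a, P (h a)) ->
  excess H mu P = excess H0 mu xpredT.
Proof.
have [hI _] := Hh; move=> Ph.
rewrite /excess (bigID (mem (codom h))) /= [X in _ + X]big1 ?addr0; last first.
  move=> v /andP[_ vh]; rewrite (resolvent_excess degH) big_pred0 ?mulr0 // => u.
  apply/negP => /embeds_codom[a va]; move: vh; rewrite va => /negP; apply.
  exact: codom_f.
under [RHS]eq_bigr do rewrite -embeds_resolvent.
rewrite -(big_imset (fun v => resolvent H mu v - mu^-1) (A := xpredT) (h := h)) /=;
  last by move=> ? ? _ _; exact: hI.
apply: eq_bigl => v; apply/andP/imsetP => [[_ /codomP[a ->]]|[a _ ->]].
  by exists a.
by rewrite Ph codom_f.
Qed.

Lemma embeds_excess0 (P : pred V) : (forall a, ~~ P (h a)) -> excess H mu P = 0.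
Proof.
move=> Ph; rewrite /excess big1 // => v Pv.
rewrite (resolvent_excess degH) big_pred0 ?mulr0 // => u.
by apply/negP => /embeds_codom[a va]; have := Ph a; rewrite -va Pv.
Qed.

End Embedding.

Lemma excess_solution (R : realFieldType) (V : finType) (H : sgraph V) (mu : R)
    (z : V -> R) : max_degree_lt H mu ->
  (forall v, mu * z v = 1 + \sum_(u | H v u) z u) ->
  excess H mu xpredT = \sum_v (z v - mu^-1).
Proof.
by move=> dH hz; apply: eq_bigr => v _; rewrite (resolvent_unique dH hz).
Qed.

Lemma matching_degree q a : #|matching_graph q a| = 1%N.
Proof.
(* The partner of [a] in the pair of index [a./2]: the odd member if [a] is even, and the even one
   otherwise. *)
have pa : ((a./2).*2 + ~~ odd a < q.*2)%N.
  by have := ltn_ord a; case: odd (odd_double_half a) => /=; lia.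
rewrite -(card1 (Ordinal pa)); apply: eq_card => b; rewrite !inE.
apply/idP/eqP => [|->].
  rewrite -[_ \in _]/(matching_rel a b) /matching_rel => /andP[ab /eqP hab].
  apply: val_inj => /=; move: ab; rewrite -val_eqE /=.
  have := odd_double_half a; have := odd_double_half b; rewrite -hab.
  by case: (odd a); case: (odd b) => /=; lia.
rewrite -[_ \in _]/(matching_rel a _) /matching_rel -val_eqE /=.
by have := odd_double_half a; case: (odd a) => /=; lia.
Qed.

Lemma star_sum (R : nmodType) q (F : 'I_q.+1 -> R) (a : 'I_q.+1) :
  \sum_(b | star_graph q a b) F b =
  if a == ord0 then \sum_(i < q) F (lift ord0 i) else F ord0.
Proof.
rewrite big_mkcond big_ord_recl /= {1}/star_rel eqxx.
under eq_bigr => i _ do rewrite /star_rel (_ : (lift ord0 i == ord0) = false) //.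
by case: (a == ord0) => /=; rewrite ?add0r // big1 ?addr0.
Qed.

Lemma star_degree q (a : 'I_q.+1) :
  #|star_graph q a| = if a == ord0 then q else 1%N.
Proof.
rewrite -sum1_card (star_sum (fun=> 1%N)); case: eqP => // _.
by rewrite sum_nat_const muln1 card_ord.
Qed.

Lemma complete_degree m (a : 'I_m.+1) : #|complete_graph m.+1 a| = m.
Proof.
transitivity #|predC1 a|; last by rewrite cardC1 card_ord.
by apply: eq_card => b; rewrite !inE -[_ \in _]/(a != b) eq_sym.
Qed.

(** * Closed forms of the excess for matchings, stars and the triangle *)

Section ExplicitExcess.
Variables (R : realFieldType) (mu : R) (q : nat).

Lemma excess_matching : 1 < mu ->
  excess (matching_graph q) mu xpredT = (2 * q)%:R / (mu * (mu - 1)).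
Proof.
move=> mu1; have mu0 := lt_trans ltr01 mu1.
have muN0 := lt0r_neq0 mu0; have m1N0 : mu - 1 != 0 by rewrite gt_eqF ?subr_gt0.
rewrite (excess_solution (z := fun=> (mu - 1)^-1)).
- by rewrite sumr_const card_ord -mul2n -mulr_natr; field; apply/andP.
- by move=> a; rewrite matching_degree.
by move=> a; rewrite sumr_const matching_degree; field.
Qed.

Lemma excess_star : q%:R < mu -> 1 < mu ->
  excess (star_graph q) mu xpredT =
    q%:R * (2 * mu + q%:R + 1) / (mu * (mu ^+ 2 - q%:R)).
Proof.
move=> muq mu1; have mu0 := lt_trans ltr01 mu1; have muN0 := lt0r_neq0 mu0.
have dN0 : mu ^+ 2 - q%:R != 0 by rewrite gt_eqF ?subr_gt0 //; nra.
(* The values at the centre and at a leaf solve [mu c = 1 + q l] and [mu l = 1 + c]. *)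
pose c := (mu + q%:R) / (mu ^+ 2 - q%:R); pose l := (mu + 1) / (mu ^+ 2 - q%:R).
rewrite (excess_solution (z := fun a => if a == ord0 then c else l)).
- rewrite big_ord_recl /= sumr_const card_ord -mulr_natl /c /l.
  by field; apply/andP.
- by move=> a; rewrite star_degree; case: ifP.
move=> a; rewrite star_sum eqxx; case: ifP => _.
  rewrite sumr_const card_ord -mulr_natl /c /l; by field.
by rewrite /c /l; field.
Qed.

Lemma excess_triangle : 2 < mu ->
  excess (complete_graph 3) mu xpredT = 6 / (mu * (mu - 2)).
Proof.
move=> mu2; have muN0 : mu != 0 by rewrite gt_eqF //; lra.
have m2N0 : mu - 2 != 0 by rewrite gt_eqF ?subr_gt0.
rewrite (excess_solution (z := fun=> (mu - 2)^-1)).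
- by rewrite sumr_const card_ord -mulr_natr; field; apply/andP.
- by move=> a; rewrite complete_degree.
by move=> a; rewrite sumr_const complete_degree -mulr_natr; field.
Qed.

End ExplicitExcess.

(** * Complete multipartite graphs with inner edges *)

(** For [v i = n_i / mu] the equation [saturation v = 1] reads: the sum of [n_i / (mu + n_i)] is 1.
    This is the classical equation for the spectral radius of a complete multipartite graph. *)
Definition saturation (R : fieldType) (I : finType) (v : I -> R) : R :=
  \sum_i v i / (1 + v i).

Section Multipartite.
Variables (V I : finType) (c : V -> I) (G : sgraph V).

Definition inner_rel : rel V := fun x y => (c x == c y) && G x y.

Fact inner_sym : symmetric inner_rel.
Proof. by move=> x y; rewrite /inner_rel eq_sym adj_sym. Qed.

Fact inner_irr : irreflexive inner_rel.
Proof. by move=> x; rewrite /inner_rel adj_irr andbF. Qed.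

Definition inner : sgraph V := SGraph inner_sym inner_irr.

Variables (R : realType) (mu : R).
Hypothesis degH : max_degree_lt inner mu.
Hypothesis completeG : forall x y, c x != c y -> G x y.

Definition mass (i : I) : R :=
  #|[pred v | c v == i]|%:R / mu + excess inner mu [pred v | c v == i].

Definition level : R := saturation mass.

Lemma massE i : mass i = \sum_(v | c v == i) resolvent inner mu v.
Proof.
by rewrite /mass /excess sumrB sumr_const -[mu^-1 *+ _]mulr_natl addrC subrK.
Qed.

Lemma mass_ge0 i : 0 <= mass i.
Proof. by rewrite massE; apply: sumr_ge0 => v _; exact/ltW/resolvent_gt0. Qed.

Let x v := resolvent inner mu v / (1 + mass (c v)).

Lemma mass_1D_gt0 i : 0 < 1 + mass i.
Proof. by apply: ltr_pwDl => //; exact: mass_ge0. Qed.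

Let x_gt0 v : 0 < x v.
Proof. by rewrite divr_gt0 ?mass_1D_gt0 // resolvent_gt0. Qed.

Let sum_part i : \sum_(v | c v == i) x v = mass i / (1 + mass i).
Proof. by rewrite [X in X / _]massE mulr_suml; apply: eq_bigr => v /eqP <-. Qed.

Let sum_x : \sum_v x v = level.
Proof.
rewrite (partition_big c xpredT) //=; apply: eq_bigr => i _; exact: sum_part.
Qed.

(** The test vector satisfies the eigenvalue equation up to the constant [level - 1]: neighbours in
    other parts contribute [level] minus the share of the own part, and the resolvent equation
    evaluates those in the own part. *)
Let adj_x v : \sum_(u | G v u) x u = mu * x v + (level - 1).
Proof.
rewrite (bigID (fun u => c v == c u)) /=.
have -> : \sum_(u | G v u && (c v != c u)) x u = level - mass (c v) / (1 + mass (c v)).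
  apply/eqP; rewrite eq_sym subr_eq -sum_x -sum_part; apply/eqP.
  rewrite [LHS](bigID (fun u => c u == c v)) /= addrC; congr (_ + _).
  apply: eq_bigl => u; rewrite [c u == c v]eq_sym.
  by case cvu: (c v == c u); rewrite ?andbF //= completeG ?cvu.
have -> : \sum_(u | G v u && (c v == c u)) x u =
    (mu * resolvent inner mu v - 1) / (1 + mass (c v)).
  rewrite resolventE // [1 + _]addrC addrK.
  rewrite mulr_suml; apply: eq_big => [u|u /andP[_ /eqP cvu]].
    by rewrite /= /inner_rel andbC.
  by rewrite /x cvu.
by rewrite /x; field; rewrite gt_eqF ?mass_1D_gt0.
Qed.

Let x_le v : x v <= level.
Proof.
rewrite -sum_x (bigD1 v) //= lerDl; apply: sumr_ge0 => u _; exact: ltW.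
Qed.

Variable v0 : V.

Let level_gt0 : 0 < level.
Proof. exact: lt_le_trans (x_gt0 v0) (x_le v0). Qed.

(** Since [x v <= level], the defect [level - 1 <= 0] is at most [(level - 1) / level] times [x v],
    so it is absorbed into the eigenvalue. Keeping this term yields strictness later. *)
Lemma lambda_le_level : level <= 1 -> lambda R G <= mu + (level - 1) / level.
Proof.
move=> l1; have h v : \sum_(u | G v u) x u <= (mu + (level - 1) / level) * x v.
  rewrite adj_x mulrDl lerD2l mulrAC -mulrA.
  by rewrite -[leLHS]mulr1 ler_wnM2l ?subr_le0 // ler_pdivrMr // mul1r.
apply: (lambda_le x_gt0 _ h).
rewrite -(pmulr_lge0 _ (x_gt0 v0)); apply: le_trans (h v0).
by apply: sumr_ge0 => u _; exact: ltW.
Qed.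

Lemma lambda_ge_level : 1 <= level -> mu + (level - 1) / level <= lambda R G.
Proof.
move=> l1; apply: (lambda_ge v0 x_gt0) => v.
rewrite adj_x mulrDl lerD2l mulrAC -mulrA.
by rewrite -[leRHS]mulr1 ler_wpM2l ?subr_ge0 // ler_pdivrMr // mul1r.
Qed.

Lemma lambda_le_of_level : level <= 1 -> lambda R G <= mu.
Proof.
move=> l1; apply: le_trans (lambda_le_level l1) _.
by rewrite gerDl pmulr_lle0 ?invr_gt0 // subr_le0.
Qed.

Lemma lambda_ge_of_level : 1 <= level -> mu <= lambda R G.
Proof.
move=> l1; apply: le_trans (lambda_ge_level l1).
by rewrite lerDl divr_ge0 ?subr_ge0 // ltW.
Qed.

(** At a level other than 1, the correction term of the matching bound separates the spectral radius
    from [mu]. *)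
Lemma lambda_eq_level : lambda R G = mu -> level = 1.
Proof.
move=> lm; apply/eqP; rewrite eq_le; apply/andP; split; rewrite leNgt; apply/negP => l1.
  have := lambda_ge_level (ltW l1).
  by rewrite lm gerDl leNgt divr_gt0 // subr_gt0.
have := lambda_le_level (ltW l1).
by rewrite lm lerDl leNgt pmulr_llt0 ?invr_gt0 // subr_lt0 l1.
Qed.

End Multipartite.

Definition concentrated (R : nmodType) (I : eqType) (k : I) (m : R) (i : I) : R :=
  if i == k then m else 0.

(** * Consequences of the concavity of t / (1 + t) *)

Section Increment.
Variable R : realFieldType.
Implicit Types w x y : R.

(** The growth of [t / (1 + t)] between [t = w] and [t = w + x], with the difference already
    simplified. *)
Definition increment w x := x / ((1 + w) * (1 + w + x)).

Lemma incrementE w x : 0 <= w -> 0 <= x ->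
  (w + x) / (1 + (w + x)) = w / (1 + w) + increment w x.
Proof.
by move=> w0 x0; rewrite /increment; field; apply/andP; split; rewrite gt_eqF //; lra.
Qed.

Lemma increment0 w : increment w 0 = 0.
Proof. by rewrite /increment mul0r. Qed.

Lemma ltr_increment w x y : 0 <= w -> 0 <= x -> x < y ->
  increment w x < increment w y.
Proof.
move=> w0 x0 xy; rewrite /increment ltr_pdivrMr; last by apply: mulr_gt0; lra.
rewrite mulrAC ltr_pdivlMr; last by apply: mulr_gt0; lra.
by rewrite !mulrA -!(mulrC (1 + w)) -!mulrA ltr_pM2l; [nra | lra].
Qed.

Lemma ler_increment w x y : 0 <= w -> 0 <= x -> x <= y ->
  increment w x <= increment w y.
Proof.
by move=> w0 x0; rewrite le_eqVlt => /predU1P[-> //|xy]; exact/ltW/ltr_increment.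
Qed.

(** Concavity: the chord slope is least for the largest base [w0] and the longest step [s]. As the
    bound is linear in [x], it can be summed over the parts. *)
Lemma increment_ge w x w0 s : 0 <= w <= w0 -> 0 <= x <= s ->
  x / ((1 + w0) * (1 + w0 + s)) <= increment w x.
Proof.
move=> /andP[w_ge0 ww0] /andP[x0 xs]; rewrite /increment ler_wpM2l //.
rewrite lef_pV2 ?posrE; try by apply: mulr_gt0; lra.
by apply: ler_pM; lra.
Qed.

Lemma increment_ge_eq w x w0 s : 0 <= w <= w0 -> 0 < x <= s ->
  increment w x = x / ((1 + w0) * (1 + w0 + s)) -> w = w0 /\ x = s.
Proof.
move=> /andP[w_ge0 ww0] /andP[x0 xs]; rewrite /increment.
move/(mulfI (lt0r_neq0 x0))/invr_inj => e.
have h1 : (1 + w) * (1 + w + x) <= (1 + w) * (1 + w0 + s).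
  by apply: ler_wpM2l; lra.
have h2 : w0 <= w.
  rewrite -(lerD2l 1) -(@ler_pM2r _ (1 + w0 + s)); last by lra.
  by rewrite -e.
have ew : w = w0 by apply/eqP; rewrite eq_le ww0.
split=> //; rewrite ew in e; have /mulfI/(_ _ _ e) : 1 + w0 != 0.
  by rewrite gt_eqF //; lra.
by move/addrI.
Qed.

Lemma ltr_increment_base w w0 x : 0 <= w < w0 -> 0 < x ->
  increment w0 x < increment w x.
Proof.
move=> /andP[w_ge0 ww0] x0; rewrite /increment ltr_pM2l //.
rewrite ltf_pV2 ?posrE; try by apply: mulr_gt0; lra.
by apply: ltr_pM; lra.
Qed.

(** Concavity: no chord is steeper than the tangent at the smallest base. *)
Lemma increment_le w w0 x : 0 <= w0 <= w -> 0 <= x ->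
  increment w x <= x / (1 + w0) ^+ 2.
Proof.
move=> /andP[w_ge0 ww0] x0; rewrite /increment ler_wpM2l //.
rewrite lef_pV2 ?posrE ?exprn_gt0 //; try by [apply: mulr_gt0; lra|lra].
by rewrite expr2; apply: ler_pM; lra.
Qed.

Variables (I : finType) (w x : I -> R) (k : I) (m : R).
Hypotheses (w0 : forall i, 0 <= w i) (x0 : forall i, 0 <= x i).

Lemma sum_increment (z : I -> R) : (forall i, 0 <= z i) ->
  saturation (fun i => w i + z i) = saturation w + \sum_i increment (w i) (z i).
Proof.
by move=> z0; rewrite -big_split; apply: eq_bigr => i _; rewrite incrementE.
Qed.

Hypothesis m0 : 0 < m.

Lemma sum_increment_concentrated :
  saturation (fun i => w i + concentrated k m i) = saturation w + increment (w k) m.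
Proof.
rewrite sum_increment => [|i]; last by rewrite /concentrated; case: ifP => // _; exact: ltW.
rewrite (bigD1 k) //= {1}/concentrated eqxx big1 ?addr0 // => i ik.
by rewrite /concentrated (negbTE ik) increment0.
Qed.

Let x_le i : 0 <= x i <= \sum_j x j.
Proof.
by rewrite x0 (bigD1 i) //= lerDl; apply: sumr_ge0 => j _; exact: x0.
Qed.

Let sum_x0 : 0 <= \sum_j x j.
Proof. by apply: sumr_ge0. Qed.

Section LowerBound.
Hypotheses (wk : forall i, w i <= w k) (mx : m <= \sum_i x i).

Let lower : increment (w k) m <= increment (w k) (\sum_i x i) /\
  forall i, x i / ((1 + w k) * (1 + w k + \sum_j x j)) <= increment (w i) (x i).
Proof.
split; first by apply: ler_increment => //; exact: ltW.
by move=> i; apply: increment_ge; rewrite ?w0 ?wk.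
Qed.

Lemma saturation_concentrated_le :
  saturation (fun i => w i + concentrated k m i) <= saturation (fun i => w i + x i).
Proof.
rewrite sum_increment_concentrated sum_increment // lerD2l.
case: lower => h1 h2; apply: le_trans h1 _; rewrite /increment mulr_suml.
by apply: ler_sum => i _; exact: h2.
Qed.

(** Equality throughout the chain first forces the total to be [m], then equality in each slope
    bound; so any part with positive [x] is as large as part [k] and carries the whole total. *)
Lemma saturation_concentrated_eq :
  saturation (fun i => w i + x i) = saturation (fun i => w i + concentrated k m i) ->
  \sum_i x i = m /\ exists2 i, w i = w k & forall j, j != i -> x j = 0.
Proof.
rewrite sum_increment_concentrated sum_increment // => /addrI e.
have [h1 h2] := lower.
have h3 : increment (w k) (\sum_i x i) <= \sum_i increment (w i) (x i).
  by rewrite {1}/increment mulr_suml; apply: ler_sum => i _; exact: h2.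
have xm : \sum_i x i = m.
  apply/eqP; rewrite eq_le mx andbT leNgt; apply/negP => mlt.
  have := ltr_increment (w0 k) (ltW m0) mlt.
  by rewrite ltNge (le_trans h3) // e.
split=> //; have : \sum_i (increment (w i) (x i) -
    x i / ((1 + w k) * (1 + w k + \sum_j x j))) = 0.
  by rewrite sumrB -mulr_suml -/(increment _ _) e xm subrr.
move/eqP; rewrite psumr_eq0 => [/allP h|i _]; last by rewrite subr_ge0.
have key i : 0 < x i -> w i = w k /\ x i = \sum_j x j.
  move=> xi; apply: increment_ge_eq; rewrite ?w0 ?wk ?xi //=.
    by have /andP[] := x_le i.
  by have := h i (mem_index_enum i); rewrite /= subr_eq0 => /eqP.
have [i xi|xN] := pickP (fun i => 0 < x i); last first.
  have : \sum_i x i <= 0 by apply: sumr_le0 => i _; rewrite leNgt xN.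
  by rewrite xm leNgt m0.
have [wi xiS] := key i xi.
exists i => // j ji; apply/eqP; rewrite eq_le x0 andbT.
move/eqP: xiS; rewrite [X in _ == X](bigD1 i) //= -subr_eq0 opprD addrA subrr add0r oppr_eq0.
rewrite psumr_eq0 // => /allP/(_ j (mem_index_enum j)); rewrite ji /= => /eqP ->.
exact: lexx.
Qed.

End LowerBound.

Section UpperBound.
Hypothesis wk : forall i, w k <= w i.

(** With [s] the sum of the [x i], tangents bound the left gain by [s / (1 + w k) ^+ 2]. It remains
    to see [s (1 + w k + m) < m (1 + w k)], which is the hypothesis plus [s w_k <= m w_k]. *)
Lemma saturation_lt_concentrated : (\sum_i x i) * (1 + m) < m ->
  saturation (fun i => w i + x i) < saturation (fun i => w i + concentrated k m i).
Proof.
move=> h; rewrite sum_increment_concentrated sum_increment // ltrD2l.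
apply: (@le_lt_trans _ _ ((\sum_i x i) / (1 + w k) ^+ 2)).
  rewrite mulr_suml; apply: ler_sum => i _; apply: increment_le => //.
  by rewrite w0 wk.
have p1 : 0 < 1 + w k by apply: ltr_pwDl.
have p2 : 0 < 1 + w k + m by apply: addr_gt0.
rewrite /increment expr2 ltr_pdivrMr ?mulr_gt0 // mulrAC ltr_pdivlMr ?mulr_gt0 //.
rewrite !mulrA -!(mulrC (1 + w k)) -!mulrA ltr_pM2l //.
move: sum_x0 h; set s := \sum_i _ => s0 h.
have sm : 0 <= s * m by rewrite mulr_ge0 // ltW.
have : s * w k <= m * w k by rewrite ler_wpM2r //; lra.
by lra.
Qed.

Variable i : I.
Hypotheses (xi : forall j, j != i -> x j = 0) (xm : x i <= m).

Let sum_increment_at : \sum_j increment (w j) (x j) = increment (w i) (x i).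
Proof.
by rewrite (bigD1 i) //= big1 ?addr0 // => j /xi ->; rewrite increment0.
Qed.

(** Two moves, neither of which decreases the sum: raise [x i] to [m], then shift this mass from the
    base [w i] to the smaller base [w k]. *)
Lemma saturation_le_concentrated :
  saturation (fun i => w i + x i) <= saturation (fun i => w i + concentrated k m i).
Proof.
rewrite sum_increment_concentrated sum_increment // lerD2l sum_increment_at.
apply: le_trans (ler_increment (w0 i) (x0 i) xm) _.
have := wk i; rewrite le_eqVlt => /predU1P[-> //|h].
by apply/ltW/ltr_increment_base; rewrite ?w0.
Qed.

Lemma saturation_eq_concentrated :
  saturation (fun i => w i + x i) = saturation (fun i => w i + concentrated k m i) ->
  w i = w k /\ x i = m.
Proof.
rewrite sum_increment_concentrated sum_increment // => /addrI.
rewrite sum_increment_at => e.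
have h1 := ler_increment (w0 i) (x0 i) xm.
have ew : w i = w k.
  apply/eqP; rewrite eq_le wk andbT leNgt; apply/negP => h.
  have := @ltr_increment_base (w k) (w i) m; rewrite w0 h => /(_ isT m0).
  by rewrite -e ltNge h1.
split=> //; apply/eqP; rewrite eq_le xm leNgt; apply/negP => h.
have := ltr_increment (w0 i) (x0 i) h.
by rewrite e ew ltxx.
Qed.

End UpperBound.
End Increment.

(** * Pairs of disjoint edges *)

Section DisjointEdges.
Variables (V : finType) (H : sgraph V).
Implicit Types x y u v : V.
Local Open Scope nat_scope.

(** A dart is an oriented edge, so each edge enters twice. *)
Definition dart_sum (F : V -> V -> nat) := \sum_u \sum_(v | H u v) F u v.

Definition disjoint_pairs x y u v := [&& x != u, x != v, y != u & y != v].

(* Ordered pairs of oriented edges: each unordered pair of disjoint edges is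
   counted 8 times. *)
Definition disjoint_darts := dart_sum (fun x y => dart_sum (disjoint_pairs x y)).

(** Walks with two edges are counted by their middle vertex, and those with three edges by their
    middle dart. *)
Definition walks2 := \sum_v #|H v| ^ 2.
Definition walks3 := dart_sum (fun x y => #|H x| * #|H y|).

Lemma adj_neq x y : H x y -> x != y.
Proof. by move=> xy; apply/eqP => e; rewrite e adj_irr in xy. Qed.

Lemma dart_sumD F1 F2 :
  dart_sum (fun u v => F1 u v + F2 u v) = dart_sum F1 + dart_sum F2.
Proof. by rewrite /dart_sum -big_split; apply: eq_bigr => u _; rewrite big_split. Qed.

Lemma leq_dart_sum F1 F2 : (forall u v, H u v -> F1 u v <= F2 u v) ->
  dart_sum F1 <= dart_sum F2.
Proof. by move=> h; do 2!(apply: leq_sum => ? ?); exact: h. Qed.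

Lemma dart_sum_exchange F : dart_sum F = dart_sum (fun u v => F v u).
Proof. exact: (@sum_adj_exchange nat). Qed.

Lemma dart_sum_const k : dart_sum (fun _ _ => k) = (\sum_v #|H v|) * k.
Proof. by rewrite big_distrl; apply: eq_bigr => v _; rewrite sum_nat_const. Qed.

Lemma dart_sum_fst (F : V -> nat) : dart_sum (fun u _ => F u) = \sum_u #|H u| * F u.
Proof. by apply: eq_bigr => v _; rewrite sum_nat_const. Qed.

Lemma dart_sum_at x : dart_sum (fun u _ => x == u) = #|H x|.
Proof.
rewrite dart_sum_fst (bigD1 x) //= eqxx muln1 big1 ?addn0 // => u.
by rewrite eq_sym => /negbTE ->; rewrite muln0.
Qed.

Lemma dart_sum_at2 x : dart_sum (fun _ v => x == v) = #|H x|.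
Proof. by rewrite dart_sum_exchange dart_sum_at. Qed.

Lemma dart_sum_pair x y : dart_sum (fun u v => (x == u) && (y == v)) = H x y.
Proof.
rewrite /dart_sum (bigD1 x) //= [X in _ + X]big1 ?addn0; last first.
  by move=> u; rewrite eq_sym => /negbTE ->; rewrite big1.
rewrite eqxx /= big_mkcond (bigD1 y) //= eqxx big1 ?addn0; first by case: (H x y).
by move=> v; rewrite eq_sym => /negbTE ->; case: ifP.
Qed.

(** Every dart is disjoint from [x y] or meets it in one end, except that the two orientations of
    [x y] itself meet it twice. Incidences at [x] and at [y] total twice the respective degree. *)
Lemma dart_sum_disjoint x y : H x y ->
  dart_sum (disjoint_pairs x y) + 2 * #|H x| + 2 * #|H y| <= \sum_v #|H v| + 2.
Proof.
move=> xy; have xNy := adj_neq xy.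
have := @leq_dart_sum
  (fun u v => disjoint_pairs x y u v + ((x == u) + (x == v) + (y == u) + (y == v)))
  (fun u v => 1 + (((x == u) && (y == v)) + ((y == u) && (x == v)))).
rewrite !dart_sumD !dart_sum_at !dart_sum_at2 !dart_sum_pair dart_sum_const.
rewrite [H y x]adj_sym xy => h; suff /h : forall u v, H u v ->
  disjoint_pairs x y u v + ((x == u) + (x == v) + (y == u) + (y == v)) <=
  1 + (((x == u) && (y == v)) + ((y == u) && (x == v))) by lia.
move=> u v /adj_neq uNv; rewrite /disjoint_pairs.
have hx z : ~~ ((z == u) && (z == v)).
  by apply/negP => /andP[/eqP e /eqP e']; rewrite -e -e' eqxx in uNv.
have hu z : ~~ ((x == z) && (y == z)).
  by apply/negP => /andP[/eqP e /eqP e']; rewrite e e' eqxx in xNy.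
move: (hx x) (hx y) (hu u) (hu v).
by case: (x == u); case: (x == v); case: (y == u); case: (y == v).
Qed.

(** The previous count summed over all darts [x y]. A star attains [walks2 = q ^ 2 + q], so
    [disjoint_darts] bounds the deficit from below. *)
Lemma walks2_le q : \sum_v #|H v| = 2 * q ->
  disjoint_darts + 4 * walks2 <= 4 * (q ^ 2 + q).
Proof.
move=> hq.
have h : dart_sum (fun x y => dart_sum (disjoint_pairs x y) + 2 * #|H x| + 2 * #|H y|)
    <= dart_sum (fun _ _ => \sum_v #|H v| + 2).
  exact: leq_dart_sum dart_sum_disjoint.
rewrite dart_sum_const hq !dart_sumD -/disjoint_darts in h.
have e : dart_sum (fun x _ => #|H x|) = walks2.
  by rewrite dart_sum_fst; apply: eq_bigr => v _; rewrite mulnn.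
rewrite [dart_sum (fun _ v => #|H v|)]dart_sum_exchange !e !dart_sum_const muln0 in h.
nia.
Qed.

(** For a walk [u x y v], either [u = y], [v = x] or [u = v], or its end edges are disjoint. Each of
    the first three classes has at most [walks2] members. *)
Lemma walks3_le : walks3 <= 3 * walks2 + disjoint_darts.
Proof.
have d2 : dart_sum (fun x _ => #|H x|) = walks2.
  by rewrite dart_sum_fst; apply: eq_bigr => v _; rewrite mulnn.
pose T x y := \sum_(u | H x u) \sum_(v | H y v) (disjoint_pairs u x y v : nat).
have h : walks3 <= dart_sum (fun x y => #|H y| + #|H x| + #|H x| + T x y).
  apply: leq_dart_sum => x y xy; have xNy := adj_neq xy.
  have -> : #|H x| * #|H y| = \sum_(u | H x u) \sum_(v | H y v) 1.
    by rewrite sum_nat_const sum1_card.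
  have e1 : #|H y| = \sum_(u | H x u) \sum_(v | H y v) (u == y).
    rewrite (bigD1 y) //= eqxx sum1_card big1 ?addn0 // => u /andP[_ /negbTE ->].
    by rewrite big1.
  have e2 : #|H x| = \sum_(u | H x u) \sum_(v | H y v) (x == v).
    rewrite exchange_big /= (bigD1 x) ?[H y x]adj_sym //= eqxx sum1_card.
    by rewrite big1 ?addn0 // => v /andP[_ ]; rewrite eq_sym => /negbTE ->; rewrite big1.
  have e3 : \sum_(u | H x u) \sum_(v | H y v) (u == v) <= #|H x|.
    rewrite -sum1_card; apply: leq_sum => u _.
    rewrite big_mkcond (bigD1 u) //= eqxx big1 ?addn0; first by case: (H y u).
    by move=> v; rewrite eq_sym => /negbTE ->; case: ifP.
  apply: leq_trans (leq_add (leq_add (leqnn _) e3) (leqnn _)).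
  rewrite {1}e1 {1}e2 /T -!big_split; apply: leq_sum => u xu /=.
  rewrite -!big_split; apply: leq_sum => v yv /=; rewrite /disjoint_pairs xNy.
  by case: eqP; case: eqP; case: eqP.
apply: leq_trans h _; rewrite !dart_sumD [dart_sum (fun _ v => #|H v|)]dart_sum_exchange d2.
suff : dart_sum T <= disjoint_darts by lia.
(* A walk of the last class is determined by its end darts [x u] and [y v]; forgetting that [x] and
   [y] are adjacent only enlarges the count. *)
rewrite /disjoint_darts /T [X in _ <= X]dart_sum_exchange; apply: leq_sum => x _.
rewrite (exchange_big_dep (H x)) //=; apply: leq_sum => u xu.
rewrite /dart_sum [X in _ <= X](bigID (H x)) /= -[X in X <= _]addn0; apply: leq_add => //.
by rewrite xu; apply: eq_leq; apply: eq_bigl => y; rewrite andbT.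
Qed.

Lemma disjoint_darts_ge2 a b c d : H a b -> H c d -> disjoint_pairs a b c d ->
  2 <= dart_sum (disjoint_pairs a b).
Proof.
move=> ab cd dis; have cNd := adj_neq cd; have := @leq_dart_sum
  (fun u v => ((c == u) && (d == v)) + ((d == u) && (c == v))) (disjoint_pairs a b).
rewrite dart_sumD !dart_sum_pair [H d c]adj_sym cd => h.
apply: h => u v _; move: dis; rewrite /disjoint_pairs => /and4P[ac ad bc bd].
case: (c =P u) => [<-|_]; case: (d =P v) => [<-|_];
  rewrite ?ac ?bd ?bc ?ad ?(eq_sym d c) ?(negbTE cNd) //=;
  by case: (d =P _) => [<-|_] //; case: (c =P _) => [<-|_] //;
     rewrite ?ac ?bd ?bc ?ad.
Qed.

Lemma disjoint_pairs_sym x y u v : disjoint_pairs x y u v = disjoint_pairs u v x y.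
Proof.
rewrite /disjoint_pairs ![u == _]eq_sym ![v == _]eq_sym.
by case: eqP; case: eqP; case: eqP; case: eqP.
Qed.

(** A dart is disjoint from [a b], or from [c d], or is one of at most 8 darts joining the two
    edges. So [2 q <= S + 8], where [S] adds the darts disjoint from [a b] to those disjoint from
    [c d]; as [S >= 4], this is at most [3 S]. *)
Lemma disjoint_darts_ge q a b c d : \sum_v #|H v| = 2 * q ->
  H a b -> H c d -> disjoint_pairs a b c d -> 2 * q <= 3 * disjoint_darts.
Proof.
move=> hq ab cd dis.
have hab := disjoint_darts_ge2 ab cd dis.
have hcd : 2 <= dart_sum (disjoint_pairs c d).
  by apply: (disjoint_darts_ge2 cd ab); rewrite disjoint_pairs_sym.
have hN : dart_sum (disjoint_pairs a b) + dart_sum (disjoint_pairs c d) <= disjoint_darts.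
  have ac : c != a by have /and4P[ac _ _ _] := dis; rewrite eq_sym.
  apply: (@leq_trans (\sum_(u | u \in [:: a; c]) \sum_(v | H u v)
    dart_sum (disjoint_pairs u v))); last first.
    by rewrite [X in _ <= X](bigID (mem [:: a; c])) leq_addr.
  rewrite -big_uniq /= ?inE ?[a == c]eq_sym ?(negbTE ac) // big_cons big_seq1.
  by rewrite (bigD1 b) //= [\sum_(v | H c v) _](bigD1 d) //= leq_add ?leq_addr.
suff : 2 * q <= dart_sum (disjoint_pairs a b) + dart_sum (disjoint_pairs c d) + 8 by lia.
have aux z w : dart_sum (fun u v => (z == u) && (w == v)) <= 1.
  by rewrite dart_sum_pair leq_b1.
have := aux a c; have := aux a d; have := aux b c; have := aux b d.
have := aux c a; have := aux c b; have := aux d a; have := aux d b.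
suff : 2 * q <= dart_sum (fun u v =>
  disjoint_pairs a b u v + disjoint_pairs c d u v
   + ((a == u) && (c == v)) + ((a == u) && (d == v))
   + ((b == u) && (c == v)) + ((b == u) && (d == v))
   + ((c == u) && (a == v)) + ((c == u) && (b == v))
   + ((d == u) && (a == v)) + ((d == u) && (b == v))).
  rewrite !dart_sumD; lia.
rewrite -hq -[\sum_v _]muln1 -dart_sum_const; apply: leq_dart_sum => u v /adj_neq uNv.
rewrite /disjoint_pairs.
have hx x : ~~ ((x == u) && (x == v)).
  by apply/negP => /andP[/eqP e /eqP e']; rewrite -e -e' eqxx in uNv.
move: (hx a) (hx b) (hx c) (hx d).
have := dis; rewrite /disjoint_pairs => /and4P[ac ad bc bd].
have neq (s t z : V) : s != t -> ~~ ((s == z) && (t == z)).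
  by move=> st; apply/negP => /andP[/eqP e /eqP e']; rewrite e e' eqxx in st.
move: (neq a c u ac) (neq a d u ad) (neq b c u bc) (neq b d u bd).
move: (neq a c v ac) (neq a d v ad) (neq b c v bc) (neq b d v bd).
case: (a == u); case: (a == v); case: (b == u); case: (b == v);
case: (c == u); case: (c == v); case: (d == u); case: (d == v) => //.
Qed.

End DisjointEdges.

(** * Recognition of stars, triangles and matchings *)

Section Classification.
Variables (V : finType) (H : sgraph V) (q : nat).
Local Open Scope nat_scope.

Lemma embeds_sum_degree (W : finType) (H0 : sgraph W) (h : W -> V) :
  embeds H0 H h -> \sum_v #|H v| = \sum_a #|H0 a|.
Proof.
move=> Hh; have [hI _] := Hh.
rewrite (bigID (mem (codom h))) /= [X in _ + X]big1 ?addn0; last first.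
  move=> v vh; apply: eq_card0 => u; apply/negP => vu.
  by case: (embeds_codom Hh vu) vh => a -> /negP; apply; exact: codom_f.
under [RHS]eq_bigr do rewrite -(embeds_degree Hh).
rewrite -(big_imset (fun v => #|H v|) (A := xpredT) (h := h)) /=;
  last by move=> ? ? _ _; exact: hI.
by apply: eq_bigl => v; apply/codomP/imsetP => [[a ->]|[a _ ->]]; exists a.
Qed.

Lemma exists_edge : 0 < q -> \sum_v #|H v| = 2 * q -> exists a b, H a b.
Proof.
case: (pickP (fun p : V * V => H p.1 p.2)) => [[a b] ab|h0]; first by exists a, b.
move=> q0; rewrite big1 => [|v _]; first by lia.
by apply: eq_card0 => u; exact: (h0 (v, u)).
Qed.

(** All darts start or end at [a], so its degree is [q]; the embedding lists [a] first and then its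
    neighbours. *)
Lemma embeds_star a : (forall u v, H u v -> u = a \/ v = a) ->
  \sum_v #|H v| = 2 * q -> exists h, embeds (star_graph q) H h.
Proof.
move=> ha hq.
have da : #|H a| = q.
  apply/eqP; rewrite -(eqn_pmul2l (m := 2)) // -hq -[X in _ == X]muln1.
  rewrite -(dart_sum_const H 1) mul2n -addnn -{1}dart_sum_at -dart_sum_at2 -dart_sumD.
  apply/eqP; apply: eq_bigr => u _; apply: eq_bigr => v uv.
  have := adj_neq uv; case: (ha _ _ uv) => ->; rewrite eqxx.
    by move=> /negbTE ->.
  by rewrite eq_sym => /negbTE ->.
pose s := a :: enum (H a).
have ss : size s = q.+1 by rewrite /= -cardE da.
have su : uniq s.
  by rewrite /= enum_uniq andbT mem_enum -[_ \in _]/(H a a) adj_irr.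
exists (fun i : 'I_q.+1 => nth a s i); split.
  by move=> i j /eqP; rewrite nth_uniq ?ss // => /eqP /val_inj.
have hb : forall v, H a v -> exists2 i : 'I_q.+1, i != ord0 & nth a s i = v.
  move=> v av; have vs : v \in s by rewrite inE mem_enum [X in _ || X]av orbT.
  have iv : index v s < q.+1 by rewrite -ss index_mem.
  exists (Ordinal iv); last by rewrite nth_index.
  by rewrite -val_eqE /= (negbTE (adj_neq av)).
have hs : forall i : 'I_q.+1, i != ord0 -> H a (nth a s i).
  case=> [[//|i]] iq _ /=; rewrite -[H _ _]/(nth a (enum (H a)) i \in H a) -mem_enum.
  by apply: mem_nth; move: iq; rewrite -ss.
move=> x y; apply/idP/existsP => [xy|[i /existsP[j /and3P[ij /eqP <- /eqP <-]]]].
  have := xy; case: (ha _ _ xy) => -> {}xy.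
    have [i i0 iy] := hb _ xy; exists ord0; apply/existsP; exists i.
    by rewrite iy !eqxx /= /star_rel eqxx (negbTE i0).
  rewrite adj_sym in xy; have [i i0 ix] := hb _ xy; exists i; apply/existsP; exists ord0.
  by rewrite ix !eqxx /= /star_rel eqxx (negbTE i0).
move: ij; rewrite /= /star_rel; case: (eqVneq i ord0) => [->|i0].
  by case: (eqVneq j ord0) => [->//|j0] _ /=; exact: hs.
case: (eqVneq j ord0) => [->|//] _; rewrite adj_sym; exact: hs.
Qed.

(** An edge with one end outside the triangle could meet the three sides only in its other end, but
    no vertex lies on all three. *)
Lemma embeds_triangle a b c : H a b -> H b c -> H a c ->
  (forall x y u v, H x y -> H u v -> ~~ disjoint_pairs x y u v) ->
  exists h, embeds (complete_graph 3) H h.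
Proof.
move=> ab bc ac hd; pose s := [:: a; b; c].
have su : uniq s.
  by rewrite /= !inE negb_or (negbTE (adj_neq ab)) (negbTE (adj_neq ac))
    (negbTE (adj_neq bc)).
exists (fun i : 'I_3 => nth a s i); split.
  by move=> i j /eqP; rewrite nth_uniq // => /eqP /val_inj.
have hs : forall i j : 'I_3, i != j -> H (nth a s i) (nth a s j).
  by case=> [[|[|[|]]] //] ?; case=> [[|[|[|]]] //] ? //=; rewrite 1?adj_sym.
have hm : forall x y, H x y -> x \in s.
  move=> x y xy; rewrite !inE; apply/negP => /negP; rewrite !negb_or => /and3P[xa xb xc].
  have := hd _ _ _ _ xy ab; have := hd _ _ _ _ xy bc; have := hd _ _ _ _ xy ac.
  rewrite /disjoint_pairs xa xb xc /= !negb_and !negbK.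
  case/orP => /eqP ->.
    by case/orP => /eqP e; [have := adj_neq ab | have := adj_neq ac]; rewrite e eqxx.
  by move=> _ /orP[] /eqP e; [have := adj_neq ac | have := adj_neq bc]; rewrite e eqxx.
move=> x y; apply/idP/existsP => [xy|[i /existsP[j /and3P[ij /eqP <- /eqP <-]]]].
  have xs := hm _ _ xy; have ys : y \in s by apply: (hm y x); rewrite adj_sym.
  have ix : index x s < 3 by rewrite -[3]/(size s) index_mem.
  have iy : index y s < 3 by rewrite -[3]/(size s) index_mem.
  exists (Ordinal ix); apply/existsP; exists (Ordinal iy).
  rewrite !nth_index // !eqxx !andbT; apply: contra (adj_neq xy) => /eqP eo.
  have e : index x s = index y s := congr1 val eo.
  by rewrite -(nth_index a xs) e nth_index.
exact: hs.
Qed.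

(** Fix an edge [a b]. If some edge avoids [a], it meets [a b] in [b], giving [b c] with [c != a];
    an edge avoiding [b] likewise gives [a d] with [d != b]. These two must meet, so [c = d] and a
    triangle appears. Otherwise all edges share [a] or all share [b]. *)
Lemma star_or_triangle : 0 < q -> \sum_v #|H v| = 2 * q ->
  (forall x y u v, H x y -> H u v -> ~~ disjoint_pairs x y u v) ->
  (exists h, embeds (star_graph q) H h) \/
  (q = 3 /\ exists h, embeds (complete_graph 3) H h).
Proof.
move=> q0 hq hd.
have [a [b ab]] := exists_edge q0 hq.
case: (pickP (fun p : V * V => H p.1 p.2 && (p.1 != a) && (p.2 != a))); last first.
  move=> ha; left; apply: (embeds_star (a := a)) hq => u v uv.
  have := ha (u, v); rewrite /= uv /=.
  by case: (eqVneq u a) => [->|_]; [left | case: (eqVneq v a) => [->|]; [right|]].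
case=> u v /= /andP[/andP[uv ua] va].
case: (pickP (fun p : V * V => H p.1 p.2 && (p.1 != b) && (p.2 != b))); last first.
  move=> hb; left; apply: (embeds_star (a := b)) hq => x y xy.
  have := hb (x, y); rewrite /= xy /=.
  by case: (eqVneq x b) => [->|_]; [left | case: (eqVneq y b) => [->|]; [right|]].
case=> x y /= /andP[/andP[xy xb] yb].
have [c bc ca] : exists2 c, H b c & c != a.
  have := hd _ _ _ _ ab uv.
  rewrite /disjoint_pairs [a == u]eq_sym ua [a == v]eq_sym va /= negb_and !negbK.
  by case/orP => /eqP e; [exists v | exists u] => //; rewrite e // adj_sym.
have [d ad db] : exists2 d, H a d & d != b.
  have := hd _ _ _ _ ab xy.
  rewrite /disjoint_pairs [b == x]eq_sym xb [b == y]eq_sym yb /= !andbT negb_and !negbK.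
  by case/orP => /eqP e; [exists y | exists x] => //; rewrite e // adj_sym.
have cd : c = d.
  have := hd _ _ _ _ bc ad; rewrite /disjoint_pairs eq_sym (adj_neq ab).
  by rewrite [b == d]eq_sym db ca /= negbK => /eqP.
rewrite -cd in ad; right.
have [h Hh] := embeds_triangle ab bc ad hd; split; last by exists h.
have := embeds_sum_degree Hh; rewrite hq (eq_bigr (fun=> 2)) => [|i _]; last exact: complete_degree.
by rewrite sum_nat_const card_ord; lia.
Qed.

Lemma embeds_matching : 0 < q -> (forall v, #|H v| <= 1) -> \sum_v #|H v| = 2 * q ->
  exists h, embeds (matching_graph q) H h.
Proof.
move=> q0 h1 hq; have [x0 _] := exists_edge q0 hq.
(* The unique neighbour of [x], or [x] itself if it is isolated. *)
pose p x := odflt x [pick u | H x u].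
have pE x y : H x y -> p x = y.
  move=> xy; rewrite /p; case: pickP => [u xu|/(_ y)]; last by rewrite xy.
  by have /card_le1_eqP := h1 x; apply.
(* One end of each edge is selected, namely the one of smaller rank. *)
pose r x := H x (p x) && (enum_rank x < enum_rank (p x)).
pose s := enum r.
have ss : size s = q.
  rewrite -cardE; apply/eqP; rewrite -(eqn_pmul2l (m := 2)) // -hq -[X in _ == X]muln1.
  have e : dart_sum H (fun x y => enum_rank x < enum_rank y) = #|r|.
    rewrite -[RHS]sum1_card [RHS]big_mkcond; apply: eq_bigr => x _ /=.
    case: (pickP (H x)) => [y xy|xN].
      rewrite (big_pred1 y) => [|z]; last first.
        by apply/idP/eqP => [xz|-> //]; rewrite -(pE _ _ xy) -(pE _ _ xz).
      by rewrite -[x \in r]/(r x) /r (pE _ _ xy) xy /=; case: (_ < _).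
    rewrite big_pred0 // ifN //; apply/negP => /andP[]; by rewrite xN.
  rewrite mul2n -addnn -{1}e -e [X in _ + X == _]dart_sum_exchange -dart_sumD.
  rewrite -dart_sum_const; apply/eqP; apply: eq_bigr => x _; apply: eq_bigr => y xy.
  have := adj_neq xy; case: ltngtP => // /ord_inj/enum_rank_inj ->; by rewrite eqxx.
have pp x : H x (p x) -> p (p x) = x by move=> xp; apply: pE; rewrite adj_sym.
pose e k := nth x0 s k.
have er k : k < q -> r (e k).
  by rewrite -ss => kq; have := mem_nth x0 kq; rewrite mem_enum.
have eI k l : k < q -> l < q -> e k = e l -> k = l.
  by move=> kq lq /eqP; rewrite nth_uniq ?ss ?enum_uniq // => /eqP.
have half (i : 'I_q.*2) : i./2 < q by rewrite ltn_half_double.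
(* Indices [2k] and [2k + 1] go to the selected end of the [k]-th edge and to its partner. *)
pose h (i : 'I_q.*2) := if odd i then p (e i./2) else e i./2.
have neq k l : k < q -> l < q -> p (e k) <> e l.
  move=> /er/andP[kp kr] /er/andP[lp lr] kl; move: kr lr.
  by rewrite -kl pp //; case: ltngtP.
exists h; split.
  move=> i j hij; apply: val_inj; rewrite /= -(odd_double_half i) -(odd_double_half j).
  have [ip ir] := andP (er _ (half i)); have [jp jr] := andP (er _ (half j)).
  move: hij; rewrite /h; case: (odd i); case: (odd j).
  - by move=> /(congr1 p); rewrite !pp // => /eI ->.
  - by move/neq => /(_ (half i) (half j)).
  - by move/esym/neq => /(_ (half j) (half i)).
  by move/eI => ->.
move=> x y; apply/idP/existsP => [xy|[i /existsP[j /and3P[ij /eqP <- /eqP <-]]]].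
  wlog xr : x y xy / enum_rank x < enum_rank y.
    move=> hw; case: (ltngtP (enum_rank x) (enum_rank y)) => [|yx|/ord_inj/enum_rank_inj e0].
    - exact: hw.
    - have [||i /existsP[j /and3P[ij ix jy]]] := hw y x; rewrite 1?adj_sym //.
      by exists j; apply/existsP; exists i; rewrite adj_sym ij ix jy.
    by have := adj_neq xy; rewrite e0 eqxx.
  have xs : x \in s by rewrite mem_enum -[_ \in _]/(r x) /r (pE _ _ xy) xy.
  have kq : index x s < q by rewrite -ss index_mem.
  have k0 : (index x s).*2 < q.*2 by rewrite ltn_double.
  have k1 : (index x s).*2.+1 < q.*2 by rewrite ltn_Sdouble.
  exists (Ordinal k0); apply/existsP; exists (Ordinal k1).
  rewrite /h /= /matching_rel -val_eqE /= odd_double doubleK uphalf_double eqxx andbT.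
  by rewrite /e nth_index // (pE _ _ xy) !eqxx -[_ == _.+1]/(_ == _) neq_ltn ltnSn.
move: ij; rewrite /= /matching_rel -val_eqE /= => /andP[ij /eqP hij].
have [ip _] := andP (er _ (half i)); rewrite /h -hij.
have : odd i != odd j.
  by apply: contra ij => /eqP o; rewrite -(odd_double_half i) -(odd_double_half j) o hij.
by case: (odd i); case: (odd j) => // _; rewrite 1?adj_sym.
Qed.

End Classification.

(** * Isomorphisms *)

Section KeyedBijection.
Variables (V W : finType) (K : eqType) (p : V -> K) (p' : W -> K).

(** Fibres over the same key have equal size, so elements are matched by their positions in the
    enumerations of the fibres. *)
Lemma keyed_injection (w0 : W) :
  (forall k, #|[pred v | p v == k]| = #|[pred w | p' w == k]|) ->
  exists2 f : V -> W, injective f & forall v, p' (f v) = p v.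
Proof.
move=> h; pose f v := nth w0 (enum [pred w | p' w == p v])
  (index v (enum [pred u | p u == p v])).
have fi v : (index v (enum [pred u | p u == p v]) < size (enum [pred w | p' w == p v]))%N.
  by rewrite -cardE -h cardE index_mem mem_enum inE.
have fp v : p' (f v) = p v.
  by have := mem_nth w0 (fi v); rewrite mem_enum inE => /eqP.
exists f => // v v' e; have pv : p v = p v' by rewrite -fp e fp.
move/eqP: e; rewrite /f -pv nth_uniq ?enum_uniq //; last by rewrite pv; exact: fi.
move/eqP => /(congr1 (nth v (enum [pred u | p u == p v]))).
by rewrite !nth_index // mem_enum inE ?pv.
Qed.

End KeyedBijection.

Lemma keyed_bijection (V W : finType) (K : eqType) (p : V -> K) (p' : W -> K)
    (v0 : V) (w0 : W) :
  (forall k, #|[pred v | p v == k]| = #|[pred w | p' w == k]|) ->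
  exists2 f : V -> W, bijective f & forall v, p' (f v) = p v.
Proof.
move=> h; have [f fI fp] := keyed_injection w0 h.
have [g gI _] := keyed_injection v0 (fun k => esym (h k)).
by exists f => //; apply: (inj_card_bij fI); exact: leq_card gI.
Qed.

(** The key [None] marks vertices outside the copy of the inner graph; they are counted by
    subtracting the copy from the colour class. *)
Lemma card_color_unplaced (U V I : finType) (c : V -> I) (h : U -> V) (j : I) :
  injective h ->
  #|[pred v | (c v, [pick a | h a == v]) == (j, None)]| =
  (#|[pred v | c v == j]| - #|[pred a | c (h a) == j]|)%N.
Proof.
move=> hI; have <- : #|[pred v | (c v == j) && (v \in codom h)]| = #|[pred a | c (h a) == j]|.
  rewrite -(card_imset _ hI); apply: eq_card => v; rewrite inE /=.
  apply/andP/imsetP => [[cv /codomP[a e]]|[a]]; first by exists a; rewrite // inE -e.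
  by rewrite inE => ca ->; split=> //; exact: codom_f.
rewrite -(cardID (mem (codom h)) [pred v | c v == j]).
have -> : #|predI [pred v | c v == j] (mem (codom h))| =
  #|[pred v | (c v == j) && (v \in codom h)]| by apply: eq_card.
rewrite addKn; apply: eq_card => v; rewrite !inE xpair_eqE andbC; congr (_ && _).
case: pickP => [a /eqP <-|ha]; first by rewrite codom_f.
rewrite eqxx; have -> // : (v \in codom h) = false.
by apply/negP => /codomP[a e]; have := ha a; rewrite e eqxx.
Qed.

Lemma pick_preimage (U V : finType) (h : U -> V) (v : V) (a : U) : injective h ->
  ([pick b | h b == v] == Some a) = (h a == v).
Proof.
move=> hI; case: pickP => [b /eqP <-|hb]; last by rewrite hb.
by rewrite (inj_eq hI) eq_sym.
Qed.

Section MultipartiteIso.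
Variables (V W U I : finType) (c : V -> I) (d : W -> I).
Variables (G : sgraph V) (G' : sgraph W) (H0 : sgraph U) (h : U -> V) (h' : U -> W).
Hypotheses (Gc : forall x y, c x != c y -> G x y)
           (Gd : forall x y, d x != d y -> G' x y).
Hypotheses (Hh : embeds H0 (inner c G) h) (Hh' : embeds H0 (inner d G') h').

(** Each vertex is keyed by its colour and its preimage in [U], if any. A bijection preserving this
    key is an isomorphism: distinct colours are always adjacent, and adjacency within a colour is
    read off from [H0]. *)
Lemma multipartite_iso (v0 : V) (w0 : W) :
  (forall i, #|[pred v | c v == i]| = #|[pred w | d w == i]|) ->
  (forall a, c (h a) = d (h' a)) -> graph_iso G G'.
Proof.
move=> cd hh'; have [hI hE] := Hh; have [hI' hE'] := Hh'.
pose p v := (c v, [pick a | h a == v]); pose p' w := (d w, [pick a | h' a == w]).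
have [|f fb fp] := @keyed_bijection V W _ p p' v0 w0.
  case=> j [a|]; last first.
    rewrite !card_color_unplaced // cd; congr (_ - _)%N.
    by apply: eq_card => a; rewrite !inE hh'.
  have one (T : finType) (e : T -> I) (g : U -> T) : injective g ->
      #|[pred v | (e v, [pick b | g b == v]) == (j, Some a)]| = (e (g a) == j).
    move=> gI.
    have [ej|ej] := eqVneq (e (g a)) j.
      rewrite -[RHS](card1 (g a)); apply: eq_card => v.
      rewrite !inE xpair_eqE pick_preimage // eq_sym.
      by case: (eqVneq v (g a)) => [->|_]; rewrite ?ej ?eqxx ?andbF // andbC.
    apply: eq_card0 => v; rewrite !inE xpair_eqE pick_preimage //.
    by apply/negP => /andP[ev /eqP gv]; rewrite gv ev in ej.
  by rewrite /p /p' !one // hh'.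
exists f => // x y.
have fc v : d (f v) = c v by have [] := fp v.
have fpick v a : (h' a == f v) = (h a == v).
  by rewrite -!pick_preimage //; have [_ ->] := fp v.
have [cxy|cxy] := eqVneq (c x) (c y); last by rewrite Gc // Gd // !fc.
have <- : inner c G x y = G x y by rewrite /= /inner_rel cxy eqxx.
have <- : inner d G' (f x) (f y) = G' (f x) (f y) by rewrite /= /inner_rel !fc cxy eqxx.
rewrite hE hE'; apply: eq_existsb => a; apply: eq_existsb => b.
by rewrite !fpick.
Qed.

End MultipartiteIso.

(** Handshake lemma: exactly two darts lie over each edge, seen as a two-element set. *)
Lemma sum_degree_edges (V : finType) (G : sgraph V) :
  (\sum_v #|G v| = 2 * #|edge_set G|)%N.
Proof.
transitivity (\sum_(p : V * V | G p.1 p.2) 1)%N.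
  rewrite -(pair_big_dep xpredT (fun x y => G x y) (fun _ _ => 1%N)) /=.
  by apply: eq_bigr => v _; rewrite sum1_card.
rewrite (partition_big (fun p : V * V => [set p.1; p.2]) (mem (edge_set G))) /=; last first.
  by move=> [x y] /= xy; rewrite inE; apply/existsP; exists x; apply/existsP; exists y;
    rewrite xy eqxx.
rewrite (eq_bigr (fun=> 2%N)); first by rewrite sum_nat_const mulnC.
move=> e; rewrite inE => /existsP[x /existsP[y /andP[xy /eqP ->]]].
have xNy : x != y by apply/eqP => e'; rewrite e' adj_irr in xy.
have <- : #|[set (x, y); (y, x)]| = 2%N.
  by rewrite cards2 xpair_eqE (negbTE xNy).
rewrite sum1_card; apply: eq_card => -[u v]; rewrite !inE !xpair_eqE /=.
rewrite -[_ \in _]/(G u v && ([set u; v] == [set x; y])).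
apply/andP/orP => [[uv /eqP e']|].
  have uNv : u != v by apply/eqP => e2; rewrite e2 adj_irr in uv.
  have : u \in [set x; y] by rewrite -e' set21.
  have : v \in [set x; y] by rewrite -e' set22.
  rewrite !inE => /orP[] /eqP ev /orP[] /eqP eu; rewrite eu ev ?eqxx in uNv *;
    by [right|left|].
case=> /andP[/eqP -> /eqP ->]; first by rewrite xy eqxx.
by rewrite adj_sym xy finset.setUC eqxx.
Qed.

(** * The residue classes as parts of the Turán graph *)

Section TuranColoring.
Variables (n r : nat) (r_gt0 : (0 < r)%N).

Definition residue (x : 'I_n) : 'I_r := Ordinal (ltn_pmod x r_gt0).

Definition part_size (i : 'I_r) := #|[pred x | residue x == i]|.

Lemma residue_eq (x y : 'I_n) : (residue x == residue y) = (x %% r == y %% r)%N.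
Proof. by rewrite -val_eqE. Qed.

Lemma part_size_mono (i j : 'I_r) : (i <= j)%N -> (part_size j <= part_size i)%N.
Proof.
(* Shifting down by [j - i] injects class [j] into class [i]; members of class [j] are at least [j],
   so the truncated subtraction is exact on them. *)
move=> ij; pose f (x : 'I_n) : 'I_n := insubd x (x - (j - i))%N.
have fE (x : 'I_n) : val (f x) = (x - (j - i))%N.
  by rewrite val_insubd (leq_ltn_trans (leq_subr _ _) (ltn_ord x)).
have xj (x : 'I_n) : residue x == j -> (x = x %/ r * r + j :> nat)%N.
  by rewrite -val_eqE /= => /eqP <-; rewrite -divn_eq.
rewrite /part_size -(@card_in_imset _ _ f) => [|x y]; last first.
  rewrite !inE => /xj hx /xj hy /(congr1 val); rewrite !fE => e.
  apply: val_inj; move: hx hy e => /=.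
  by move: (x %/ r * r)%N (y %/ r * r)%N; lia.
apply/subset_leq_card/fintype.subsetP => _ /imsetP[x /xj hx ->].
rewrite inE -val_eqE /= fE {1}hx.
have -> : (x %/ r * r + j - (j - i) = x %/ r * r + i)%N.
  by move: (x %/ r * r)%N; lia.
by rewrite modnMDl modn_small.
Qed.

(** Within a class, an element is determined by its quotient modulo [r], which is at most
    [n %/ r]. *)
Lemma part_size_le (i : 'I_r) : (part_size i <= (n %/ r).+1)%N.
Proof.
rewrite /part_size -[X in (_ <= X)%N]card_ord.
pose f (x : 'I_n) : 'I_(n %/ r).+1 := inord (x %/ r).
have fE (x : 'I_n) : val (f x) = (x %/ r)%N.
  by rewrite /= inordK // ltnS leq_div2r // ltnW.
rewrite -(@card_in_imset _ _ f) ?max_card // => x y; rewrite !inE.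
move=> /eqP xi /eqP yi /(congr1 val); rewrite !fE => e; apply: val_inj => /=.
have /(congr1 val) /= m : residue x = residue y by rewrite xi yi.
by rewrite (divn_eq x r) (divn_eq y r) e m.
Qed.

Lemma card_involutive_residue (s : 'I_r -> 'I_r) (i : 'I_r) : involutive s ->
  #|[pred x | s (residue x) == i]| = part_size (s i).
Proof. by move=> sK; apply: eq_card => x; rewrite !inE inv_eq. Qed.

Lemma turan_embed_complete i m (H : sgraph 'I_m) (x y : 'I_n) :
  residue x != residue y -> turan_embed n r i H x y.
Proof. by rewrite residue_eq /= /turan_embed_rel /= /turan_rel => ->. Qed.

Lemma embeds_turan_embed (i : 'I_r) m (H : sgraph 'I_m) : (m * r <= n)%N ->
  exists2 h, embeds H (inner residue (turan_embed n r i H)) h &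
    forall a, residue (h a) = i.
Proof.
move=> mrn.
have hb (a : 'I_m) : (a * r + i < n)%N.
  apply: leq_trans mrn; apply: leq_trans (_ : a.+1 * r <= _)%N.
    by rewrite mulSn addnC ltn_add2r.
  by rewrite leq_mul2r ltn_ord orbT.
pose h a := Ordinal (hb a).
have hm a : residue (h a) = i by apply: val_inj; rewrite /= modnMDl modn_small.
have hd (a : 'I_m) : ((a * r + i) %/ r = a)%N.
  by rewrite divnMDl // divn_small // addn0.
have hE a x : (h a == x) = (residue x == i) && (a == x %/ r :> nat)%N.
  apply/eqP/andP => [<-|[/eqP xi /eqP ax]]; first by rewrite hm eqxx /= hd.
  by apply: val_inj; rewrite /= ax -xi /= -divn_eq.
exists h => //; split.
  by move=> a b /(congr1 (fun x : 'I_n => x %/ r)%N) /=; rewrite !hd => /val_inj.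
move=> x y; rewrite /= /inner_rel /= /turan_embed_rel /= /turan_rel residue_eq.
have -> : ((x %% r == i) = (residue x == i))%N by rewrite -val_eqE.
have -> : ((y %% r == i) = (residue y == i))%N by rewrite -val_eqE.
rewrite -residue_eq; apply/andP/existsP.
  case=> xy; rewrite xy /= => /and3P[xi yi /existsP[a /existsP[b /and3P[ab ax bx]]]].
  by exists a; apply/existsP; exists b; rewrite ab !hE xi yi ax bx.
case=> a /existsP[b /and3P[ab]]; rewrite !hE => /andP[xi ax] /andP[yi ay].
rewrite (eqP xi) (eqP yi) eqxx /=; split=> //.
by apply/existsP; exists a; apply/existsP; exists b; rewrite ab ax ay.
Qed.

Variable G : sgraph 'I_n.
Hypothesis GT : forall x y, turan n r x y -> G x y.

Lemma residue_complete x y : residue x != residue y -> G x y.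
Proof. by rewrite residue_eq => h; apply: GT. Qed.

Lemma degree_inner v : #|G v| = (#|turan n r v| + #|inner residue G v|)%N.
Proof.
rewrite -(cardID (mem (turan n r v)) (G v)); congr (_ + _)%N; apply: eq_card => u.
  rewrite !inE /=; apply/andP/idP => [[]//|h]; split=> //; exact: GT.
rewrite !inE; change (~~ turan n r v u && G v u = inner residue G v u).
by rewrite /= /turan_rel /inner_rel negbK residue_eq.
Qed.

Lemma sum_degree_inner q : #|edge_set G| = (#|edge_set (turan n r)| + q)%N ->
  (\sum_v #|inner residue G v| = 2 * q)%N.
Proof.
move=> hq; have sG := sum_degree_edges G; have sT := sum_degree_edges (turan n r).
have : (\sum_v #|G v| = \sum_v #|turan n r v| + \sum_v #|inner residue G v|)%N.
  by rewrite -big_split; apply: eq_bigr => v _; exact: degree_inner.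
by rewrite sG sT hq; lia.
Qed.

Lemma degree_ge v : (n - (n %/ r).+1 <= #|G v|)%N.
Proof.
apply: (@leq_trans #|[predC [pred x | residue x == residue v]]|).
  have := cardC [pred x | residue x == residue v]; rewrite card_ord.
  move=> {1}<-; rewrite leq_subLR leq_add2r; exact: part_size_le.
apply/subset_leq_card/fintype.subsetP => u; rewrite !inE => uv.
by apply: residue_complete; rewrite eq_sym.
Qed.

End TuranColoring.

(** * Comparison at the spectral radius *)

Lemma card_edge_set_iso (V W : finType) (G : sgraph V) (H : sgraph W) :
  graph_iso G H -> #|edge_set G| = #|edge_set H|.
Proof.
case=> f fb fm; apply/eqP; rewrite -(eqn_pmul2l (m := 2)) // -!sum_degree_edges.
rewrite [X in _ == X](reindex f) /=; last exact: onW_bij.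
apply/eqP; apply: eq_bigr => v _; rewrite -!sum1_card [RHS](reindex f) /=; last exact: onW_bij.
by apply: eq_bigl => u; rewrite -[LHS]fm.
Qed.

(** Among the [2 q] darts, those starting at [v] and those ending at [v] are disjoint families of
    size [#|H v|]. *)
Lemma degree_le_edges (V : finType) (H : sgraph V) q (v : V) :
  (\sum_v #|H v| = 2 * q -> #|H v| <= q)%N.
Proof.
move=> hq; rewrite -(leq_pmul2l (m := 2)) // -hq -[leqRHS]muln1 -(dart_sum_const H 1).
rewrite mul2n -addnn -{1}dart_sum_at -dart_sum_at2 -dart_sumD.
apply: leq_dart_sum => x y xy; case: (eqVneq v x) => [->|_]; last exact: leq_b1.
by rewrite (negbTE (adj_neq xy)).
Qed.

Lemma max_degree_lt_embeds (R : realFieldType) (W V : finType) (H0 : sgraph W)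
    (H : sgraph V) (h : W -> V) (mu : R) :
  embeds H0 H h -> 0 < mu -> max_degree_lt H0 mu -> max_degree_lt H mu.
Proof.
move=> Hh mu0 d v; have [u vu|v0] := pickP (H v); last by rewrite eq_card0.
by have [a ->] := embeds_codom Hh vu; rewrite (embeds_degree Hh).
Qed.

Lemma level_embeds (R : realType) (U V I : finType) (c : V -> I) (G : sgraph V)
    (H0 : sgraph U) (h : U -> V) (k : I) (mu : R) :
  embeds H0 (inner c G) h -> (forall a, c (h a) = k) ->
  max_degree_lt (inner c G) mu ->
  level c G mu = saturation (fun i => #|[pred v | c v == i]|%:R / mu
    + concentrated k (excess H0 mu xpredT) i).
Proof.
move=> Hh hk dG; apply: eq_bigr => i _.
suff -> : mass c G mu i = #|[pred v | c v == i]|%:R / mu +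
  concentrated k (excess H0 mu xpredT) i by [].
congr (_ + _); rewrite /concentrated; case: eqVneq => [->|ik].
  by apply: (embeds_excess Hh dG) => a; rewrite /= hk.
by apply: (embeds_excess0 Hh dG) => a; rewrite /= hk eq_sym.
Qed.

Lemma sum_excess (R : realFieldType) (V I : finType) (c : V -> I) (H : sgraph V)
    (mu : R) : \sum_i excess H mu [pred v | c v == i] = excess H mu xpredT.
Proof. by rewrite [RHS](partition_big c xpredT). Qed.

(* With q <= mu / 99, the gap N / (4 mu^3) of the third-order terms dominates
   both the fourth-order term w3 / (mu^3 (mu - q)) and s * m. *)
Lemma excess_gap (R : realFieldType) (q N w2 w3 mu s m : R) :
  1 <= q -> 99 * q <= mu -> 0 <= s -> 2 * q <= 3 * N ->
  N + 4 * w2 <= 4 * (q ^+ 2 + q) -> w3 <= 3 * w2 + N ->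
  s <= 2 * q / mu ^+ 2 + w2 / mu ^+ 3 + w3 / (mu ^+ 3 * (mu - q)) ->
  2 * q / mu ^+ 2 + (q ^+ 2 + q) / mu ^+ 3 <= m -> s * (1 + m) < m.
Proof.
move=> q1 qmu s0 hN h2 h3 hs hm.
have mu0 : 0 < mu by lra.
pose t := (mu ^+ 3)^-1; have t0 : 0 < t by rewrite invr_gt0 exprn_gt0.
have muN0 := lt0r_neq0 mu0.
set L := _ + _ in hm; pose u := mu^-1.
have u0 : 0 < u by rewrite invr_gt0.
have qu : q * u <= 99^-1 by rewrite ler_pdivrMr // mulrC; lra.
have hL : L <= 2 * q * u ^+ 2 * (1 + q * u).
  have -> : L = 2 * q * u ^+ 2 + (q ^+ 2 + q) * u ^+ 3 by rewrite /L /u; field.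
  have : q * u ^+ 3 <= q ^+ 2 * u ^+ 3 by rewrite ler_wpM2r ?exprn_ge0 ?(ltW u0) // expr2 ler_peMr //; lra.
  have -> : 2 * q * u ^+ 2 * (1 + q * u) =
    2 * q * u ^+ 2 + (q ^+ 2 * u ^+ 3 + q ^+ 2 * u ^+ 3) by ring.
  by rewrite lerD2l (mulrDl (q ^+ 2)) lerD2l.
have L0 : 0 <= L.
  by rewrite addr_ge0 // divr_ge0 ?exprn_ge0 ?mulr_ge0 ?addr_ge0 ?sqr_ge0 //; lra.
have Nt : 0 < N * t by rewrite mulr_gt0 //; lra.
(* From [L <= 2.1 q / mu^2], [q / mu <= 1 / 99] and [q <= 3 N / 2], the square of [L] is at most
   about [0.067 N / mu^3]. *)
have [L1 LL] : L <= 1 /\ L * L <= 7 / 100 * N * t.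
  have a0 : 0 <= q * u ^+ 2 by rewrite mulr_ge0 ?exprn_ge0 ?ltW //; lra.
  have La : L <= 21 / 10 * (q * u ^+ 2).
    apply: le_trans hL _.
    have : q * u ^+ 2 * (q * u) <= q * u ^+ 2 * 99^-1.
      by rewrite ler_wpM2l.
    have -> : 2 * q * u ^+ 2 * (1 + q * u) =
      2 * (q * u ^+ 2) + 2 * (q * u ^+ 2 * (q * u)) by ring.
    by move: (q * u ^+ 2 * (q * u)) (q * u ^+ 2) a0 => ? ?; lra.
  split.
    apply: le_trans La _; have : u <= 99^-1 by rewrite lef_pV2 ?posrE //; lra.
    have : q * u * u <= 99^-1 * u by rewrite ler_wpM2r // ltW.
    have -> : q * u ^+ 2 = q * u * u by ring.
    by move: (q * u * u) => ? ? ?; lra.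
  apply: le_trans (ler_pM L0 L0 La La) _.
  have -> : 21 / 10 * (q * u ^+ 2) * (21 / 10 * (q * u ^+ 2)) =
    (21 / 10) ^+ 2 * (q * u * (q * t)) by rewrite /t /u; field.
  have : q * u * (q * t) <= 99^-1 * (q * t).
    by rewrite ler_wpM2r // mulr_ge0 ?ltW //; lra.
  have : 2 * (q * t) <= 3 * (N * t) by rewrite !mulrA ler_pM2r.
  have -> : 7 / 100 * N * t = 7 / 100 * (N * t) by ring.
  have -> : (21 / 10 : R) ^+ 2 = 441 / 100 by field.
  by move: (q * u * (q * t)) (q * t) (N * t) Nt => ? ? ?; lra.
(* Eliminating [w2] gives [w3 <= 3 (q^2 + q) + N / 4 <= 9.25 q N], while [mu - q >= 98 q]. *)
have w3le : w3 / (mu - q) <= 11 / 100 * N.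
  rewrite ler_pdivrMr; last by lra.
  have : N * q * 98 <= N * (mu - q) by rewrite -mulrA ler_wpM2l //; lra.
  have : q ^+ 2 <= q * (3 / 2 * N) by rewrite expr2 ler_wpM2l //; lra.
  have : N <= N * q by rewrite ler_peMr //; lra.
  have : q <= q ^+ 2 by rewrite expr2 ler_peMr //; lra.
  clear hs hL hm L0 L1 LL; move: h2; rewrite -[11 / 100 * N * _]mulrA (mulrCA q).
  by move: (q ^+ 2) (N * (mu - q)) (N * q) (q * N) (mulrC q N) => *; lra.
(* The constant 14 / 100 is 1 / 4 from the deficit of [w2], less the 11 / 100 lost to [w3]. *)
have sL : s <= L - 14 / 100 * N * t.
  apply: le_trans hs _.
  have -> : 2 * q / mu ^+ 2 + w2 / mu ^+ 3 + w3 / (mu ^+ 3 * (mu - q)) =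
    2 * q / mu ^+ 2 + (w2 + w3 / (mu - q)) * t.
    by rewrite /t; field; apply/andP; split=> //; rewrite gt_eqF //; lra.
  have -> : L - 14 / 100 * N * t = 2 * q / mu ^+ 2 + (q ^+ 2 + q - 14 / 100 * N) * t.
    by rewrite /L /t; field.
  by rewrite lerD2l ler_pM2r //; lra.
have {sL}sL : s <= L - 14 / 100 * (N * t) by rewrite mulrA.
have {LL}LL : L * L <= 7 / 100 * (N * t) by rewrite mulrA.
clear hs hL w3le; clearbody L; move: (N * t) Nt sL LL => Z Z0 sL LL.
have s1 : s <= 1 by lra.
(* As [s <= 1], replacing [m] by its lower bound [L] in [m (1 - s)] is legitimate; the loss
   [L s <= L^2] is half of the available gap [14 / 100 Z]. *)
have : L * (1 - s) <= m * (1 - s) by rewrite ler_wpM2r // subr_ge0.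
have : L * s <= L * L by rewrite ler_wpM2l //; lra.
rewrite !mulrDr !mulr1 !mulrN (mulrC m s).
move: (L * s) (s * m) (L * L) LL => *; lra.
Qed.

Section Comparison.
Variables (R : realType) (n r q : nat).
Hypotheses (r_ge2 : (2 <= r)%N) (q_gt0 : (0 < q)%N) (qn : (100 * r * q <= n)%N).

Let r_gt0 : (0 < r)%N := ltnW r_ge2.
Local Notation res := (@residue n r r_gt0).
Local Notation inn := (inner res).

Variable G : sgraph 'I_n.
Hypotheses (GT : forall x y, turan n r x y -> G x y)
           (Gq : #|edge_set G| = (#|edge_set (turan n r)| + q)%N).

Let mu := lambda R G.

Let n_gt0 : (0 < n)%N.
Proof. by apply: leq_trans qn; rewrite !muln_gt0 r_gt0. Qed.

Let v0 : 'I_n := Ordinal n_gt0.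

Let q_ge1 : 1 <= q%:R :> R. Proof. by rewrite ler1n. Qed.

(** With the constant test vector, the minimum degree is a lower bound; it is at least
    [n / 2 - 1 >= 100 q - 1 >= 99 q]. *)
Let mu_ge : 99 * q%:R <= mu.
Proof.
apply: (@lambda_ge _ _ _ (fun=> 1) _ v0) => // v; rewrite mulr1 sumr_const.
rewrite -natrM ler_nat; apply: leq_trans (degree_ge r_gt0 GT v).
have h1 : (n %/ r * 2 <= n)%N.
  by apply: leq_trans (leq_trunc_div n r); rewrite leq_mul2l r_ge2 orbT.
by move: (n %/ r)%N h1 qn => k h1 qn'; nia.
Qed.

Let mu_gt1 : 1 < mu. Proof. by move: mu_ge q_ge1; lra. Qed.
Let mu_gt0 : 0 < mu. Proof. exact: lt_trans ltr01 mu_gt1. Qed.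

Let q_lt_mu : q%:R < mu. Proof. by move: mu_ge q_ge1; lra. Qed.

Let sum_degG : (\sum_v #|inn G v| = 2 * q)%N.
Proof. exact: sum_degree_inner. Qed.

Let degG : max_degree_lt (inn G) mu.
Proof.
by move=> v; apply: le_lt_trans q_lt_mu; rewrite ler_nat (degree_le_edges v sum_degG).
Qed.

Let w (i : 'I_r) : R := #|[pred v | res v == i]|%:R / mu.
Let x (i : 'I_r) : R := excess (inn G) mu [pred v | res v == i].

Let w_ge0 i : 0 <= w i. Proof. by rewrite divr_ge0 // ltW. Qed.
Let x_ge0 i : 0 <= x i. Proof. exact: excess_ge0. Qed.
Let sum_x : \sum_i x i = excess (inn G) mu xpredT.
Proof. exact: sum_excess. Qed.

Let w_mono (i j : 'I_r) : (i <= j)%N -> w j <= w i.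
Proof.
by move=> ij; rewrite ler_pM2r ?invr_gt0 // ler_nat; exact: part_size_mono.
Qed.

Let levelG : saturation (fun i => w i + x i) = 1.
Proof.
have h := lambda_eq_level degG (residue_complete GT) v0; exact: (h erefl).
Qed.

Let inner_iso (m : nat) (H0 : sgraph 'I_m) (T : sgraph 'I_n) h h' (i k : 'I_r) :
  (forall y z, res y != res z -> T y z) ->
  embeds H0 (inn G) h -> (forall a, res (h a) = i) ->
  embeds H0 (inn T) h' -> (forall a, res (h' a) = k) ->
  w i = w k -> graph_iso G T.
Proof.
move=> Tc Hh hi Hh' hk wik.
have sik : @part_size n r r_gt0 i = @part_size n r r_gt0 k.
  by have /eqP := mulIf (invr_neq0 (lt0r_neq0 mu_gt0)) wik; rewrite eqr_nat => /eqP.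
(* Swapping the colours [i] and [k], whose parts have equal size, puts both copies of [H0] into the
   same colour. *)
pose c := tperm i k \o res.
apply: (@multipartite_iso _ _ _ _ c res G T H0 h h') => //.
- by move=> y z; rewrite /c /= (inj_eq perm_inj); exact: residue_complete.
- case: Hh => hI hE; split=> // y z; rewrite -hE /= /inner_rel /c /=.
  by rewrite (inj_eq perm_inj).
- move=> j; rewrite card_involutive_residue; last exact: tpermK.
  rewrite -/(@part_size n r r_gt0 j).
  by case: tpermP => [->|->|//]; rewrite sik.
by move=> a; rewrite /c /= hi hk tpermL.
Qed.

(** The total excess of [G] is at least that of a matching, and concentrating the latter in the
    largest part gives the least level. Equality forces inner degrees at most 1 and all inner edges
    into one part of maximal size. *)
Lemma Y_graph_extremal :
  lambda R (Y_graph n r q) <= mu /\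
  (mu = lambda R (Y_graph n r q) -> graph_iso G (Y_graph n r q)).
Proof.
pose k : 'I_r := Ordinal r_gt0; pose T := Y_graph n r q.
have [h Hh hk] : exists2 h, embeds (matching_graph q) (inn T) h &
    forall a, res (h a) = k.
  by apply: (@embeds_turan_embed _ _ r_gt0 k); nia.
have Tc y z : res y != res z -> T y z by exact: turan_embed_complete.
have degT : max_degree_lt (inn T) mu.
  by apply: max_degree_lt_embeds Hh mu_gt0 _ => a; rewrite matching_degree.
set m := excess (matching_graph q) mu xpredT.
have mE : m = (2 * q)%:R / (mu * (mu - 1)) by exact: excess_matching.
have m0 : 0 < m.
  by rewrite mE divr_gt0 ?mulr_gt0 ?subr_gt0 // ltr0n muln_gt0 q_gt0.
have levelT := level_embeds Hh hk degT; rewrite -/m in levelT.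
have wk i : w i <= w k by exact: w_mono.
have mx : m <= \sum_i x i.
  by rewrite sum_x mE -sum_degG natr_sum; exact: excess_ge.
split.
  apply: (lambda_le_of_level degT Tc v0); rewrite levelT -[leRHS]levelG.
  exact: saturation_concentrated_le w_ge0 x_ge0 m0 wk mx.
move=> e; have := lambda_eq_level degT Tc v0 (esym e).
rewrite levelT => /(etrans levelG \o esym) e1.
have [xm [i wi xi]] := saturation_concentrated_eq w_ge0 x_ge0 m0 wk mx e1.
have deg1 : forall v, (#|inn G v| <= 1)%N.
  apply: (excess_eq_degree_le1 degG mu_gt1).
  by rewrite -sum_x xm mE -natr_sum sum_degG.
have [h' Hh'] := embeds_matching q_gt0 deg1 sum_degG.
apply: (@inner_iso _ _ _ h' h i k Tc Hh' _ Hh hk wi) => a.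
apply/eqP/negPn/negP => ai.
have [b ab] : exists b, matching_graph q a b.
  by apply/card_gt0P; rewrite matching_degree.
(* A matching edge outside part [i] would give its own part a positive excess. *)
apply: (@excess_eq0 _ _ _ _ degG [pred v | res v == res (h' a)] (h' a) (h' b)).
- exact: xi.
- by rewrite /=.
by rewrite (embeds_adj Hh').
Qed.

(** * Upper bound by a copy of [H0] inside a smallest part *)

Section UpperBound.
Variables (p : nat) (H0 : sgraph 'I_p) (T : sgraph 'I_n) (h : 'I_p -> 'I_n) (k : 'I_r).
Hypotheses (Tc : forall y z, res y != res z -> T y z)
  (Hh : embeds H0 (inn T) h) (hk : forall a, res (h a) = k)
  (kmin : forall i : 'I_r, (i <= k)%N)
  (noniso : forall a, exists b, H0 a b)
  (deg0 : max_degree_lt H0 mu).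
Let m := excess H0 mu xpredT.
(** What is required of the triangle for [q = 3] and of the star otherwise: [mlow] is the expansion
    of the star excess to third order, and [mmax] says that among graphs with pairwise meeting edges
    [H0] has the largest excess. *)
Hypotheses
  (mlow : 2 * q%:R / mu ^+ 2 + (q%:R ^+ 2 + q%:R) / mu ^+ 3 <= m)
  (mmax : (forall y z u v, inn G y z -> inn G u v -> ~~ disjoint_pairs y z u v) ->
     (exists h', embeds H0 (inn G) h') \/ excess (inn G) mu xpredT < m).

Let m_gt0 : 0 < m.
Proof.
apply: lt_le_trans mlow; apply: addr_gt0; rewrite divr_gt0 ?exprn_gt0 //.
  by rewrite mulr_gt0 ?ltr0n.
by rewrite addr_gt0 ?exprn_gt0 ?ltr0n.
Qed.

Let degT : max_degree_lt (inn T) mu.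
Proof. exact: max_degree_lt_embeds Hh mu_gt0 deg0. Qed.

Let levelT := level_embeds Hh hk degT.

Let wk i : w k <= w i. Proof. exact/w_mono/kmin. Qed.

Let disjoint_lt y z u v : inn G y z -> inn G u v -> disjoint_pairs y z u v ->
  saturation (fun i => w i + x i) < level res T mu.
Proof.
move=> yz uv dis; rewrite levelT; apply: saturation_lt_concentrated => //; rewrite sum_x.
pose N := disjoint_darts (inn G).
apply: (@excess_gap _ q%:R N%:R (walks2 (inn G))%:R (walks3 (inn G))%:R mu) => //.
- exact: excess_ge0.
- by rewrite -!natrM ler_nat; exact: disjoint_darts_ge sum_degG yz uv dis.
- by rewrite -natrX -!natrD -!natrM -natrD ler_nat; exact: walks2_le.
- by rewrite -natrM -natrD ler_nat; exact: walks3_le.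
have hb v' : #|inn G v'|%:R <= q%:R :> R.
  by rewrite ler_nat; exact: degree_le_edges sum_degG.
have := @excess_le _ _ _ _ degG q%:R hb; rewrite ler0n q_lt_mu => /(_ isT).
rewrite -natr_sum sum_degG natrM.
have -> : \sum_v #|inn G v|%:R ^+ 2 = (walks2 (inn G))%:R :> R.
  by rewrite natr_sum; apply: eq_bigr => v' _; rewrite natrX.
have -> // : \sum_v \sum_(u | inn G v u) #|inn G v|%:R * #|inn G u|%:R =
  (walks3 (inn G))%:R :> R.
rewrite natr_sum; apply: eq_bigr => v' _; rewrite natr_sum; apply: eq_bigr => u' _.
by rewrite natrM.
Qed.

(** Two disjoint inner edges make the comparison strict. Otherwise every inner edge meets a fixed
    edge [a b], so all of them lie in the part of [a] and the single-part comparison applies. *)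
Lemma upper_extremal : mu <= lambda R T /\ (mu = lambda R T -> graph_iso G T).
Proof.
have [/existsP[y /existsP[z /existsP[u /existsP[v /and3P[yz uv dis]]]]]|] :=
  boolP [exists y, exists z, exists u, exists v,
    [&& inn G y z, inn G u v & disjoint_pairs y z u v]].
  have := disjoint_lt yz uv dis; rewrite levelG => l1; split.
    by apply: (lambda_ge_of_level degT Tc v0); exact: ltW.
  by move=> e; rewrite (lambda_eq_level degT Tc v0 (esym e)) ltxx in l1.
move=> hN.
have nodis y z u v : inn G y z -> inn G u v -> ~~ disjoint_pairs y z u v.
  move=> yz uv; apply/negP => dis; move/negP: hN; apply.
  apply/existsP; exists y; apply/existsP; exists z.
  by apply/existsP; exists u; apply/existsP; exists v; rewrite yz uv dis.
have inn_res y z : inn G y z -> res y = res z by case/andP => /eqP.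
have [a [b ab]] := exists_edge q_gt0 sum_degG.
pose i := res a.
have edge_i y z : inn G y z -> res y = i.
  move=> yz; have := nodis _ _ _ _ ab yz; rewrite /disjoint_pairs !negb_and !negbK.
  have ib : i = res b by exact: inn_res.
  have yzr := inn_res _ _ yz.
  by case/or4P => /eqP e; [rewrite -e | rewrite yzr -e | rewrite -e -ib | rewrite yzr -e -ib].
have xi j : j != i -> x j = 0.
  move=> ji; rewrite /x excess_adj // big1 ?mulr0 // => y /eqP yj.
  by rewrite big_pred0 // => z; apply/negP => /edge_i yi; rewrite -yj yi eqxx in ji.
have xiE : x i = excess (inn G) mu xpredT.
  by rewrite -sum_x (bigD1 i) //= big1 ?addr0.
have xm : x i <= m.
  rewrite xiE; case: (mmax nodis) => [[h' Hh']|/ltW//].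
  by rewrite (embeds_excess Hh' degG).
split.
  apply: (lambda_ge_of_level degT Tc v0); rewrite levelT -[leLHS]levelG.
  exact (saturation_le_concentrated w_ge0 x_ge0 m_gt0 wk xi xm).
move=> e; have := lambda_eq_level degT Tc v0 (esym e).
rewrite levelT => /(etrans levelG \o esym) e1.
have [wi xim] := saturation_eq_concentrated w_ge0 x_ge0 m_gt0 wk xi xm e1.
case: (mmax nodis) => [[h' Hh']|]; last by rewrite -xiE xim ltxx.
apply: (@inner_iso _ _ _ h' h i k Tc Hh' _ Hh hk wi) => c.
by have [d cd] := noniso c; apply: (edge_i _ (h' d)); rewrite (embeds_adj Hh').
Qed.

End UpperBound.

Lemma L_graph_extremal :
  mu <= lambda R (L_graph n r q) /\
  (mu = lambda R (L_graph n r q) -> graph_iso G (L_graph n r q)).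
Proof.
have k_lt : (r.-1 < r)%N by rewrite prednK.
pose k : 'I_r := Ordinal k_lt.
have kmin (i : 'I_r) : (i <= k)%N by rewrite /= -ltnS prednK.
have muN0 := lt0r_neq0 mu_gt0.
have mu3 : q%:R < mu ^+ 2 by rewrite (lt_trans q_lt_mu) // expr2 ltr_pMr.
rewrite /L_graph; case: eqP => [q3|qN3].
  have [h Hh hk] := @embeds_turan_embed n _ r_gt0 k _ (complete_graph 3) ltac:(nia).
  have mu2 : 2 < mu by move: mu_ge q_ge1; lra.
  have m2N0 : mu - 2 != 0 by rewrite gt_eqF // subr_gt0.
  have m3 := excess_triangle mu2.
  apply: (@upper_extremal _ _ _ h k _ Hh hk kmin) => //.
  - exact: turan_embed_complete.
  - by move=> a; apply/card_gt0P; rewrite complete_degree.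
  - by move=> a; rewrite complete_degree.
  - rewrite m3 q3 -subr_ge0.
    have -> : 6 / (mu * (mu - 2)) - (2 * 3%:R / mu ^+ 2 + (3%:R ^+ 2 + 3%:R) / mu ^+ 3)
      = 24 / (mu ^+ 3 * (mu - 2)) by field; apply/andP.
    by rewrite divr_ge0 ?mulr_ge0 ?exprn_ge0 // ltW // subr_gt0.
  move=> nodis; case: (star_or_triangle q_gt0 sum_degG nodis) => [[h' Hh']|[_ ?]]; last by left.
  (* With three edges the star loses to the triangle: the difference of the excesses is
     [6 / (mu (mu - 2) (mu^2 - 3))]. *)
  right; rewrite (embeds_excess Hh' degG) // excess_star // m3 q3 -subr_gt0.
  have m3N0 : mu ^+ 2 - 3 != 0 by rewrite gt_eqF // subr_gt0 -q3.
  have -> : 6 / (mu * (mu - 2)) - 3%:R * (2 * mu + 3%:R + 1) / (mu * (mu ^+ 2 - 3%:R))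
    = 6 / (mu * (mu - 2) * (mu ^+ 2 - 3)) by field; do 2?[apply/andP; split=> //].
  by rewrite divr_gt0 ?mulr_gt0 ?subr_gt0 // -q3.
have [h Hh hk] := @embeds_turan_embed n _ r_gt0 k _ (star_graph q) ltac:(nia).
apply: (@upper_extremal _ _ _ h k _ Hh hk kmin) => //.
- exact: turan_embed_complete.
- by move=> a; apply/card_gt0P; rewrite star_degree; case: ifP.
- by move=> a; rewrite star_degree; case: ifP.
- rewrite excess_star // -subr_ge0.
  (* The remainder of the star expansion after third order, visibly nonnegative. *)
  have -> : q%:R * (2 * mu + q%:R + 1) / (mu * (mu ^+ 2 - q%:R)) -
      (2 * q%:R / mu ^+ 2 + (q%:R ^+ 2 + q%:R) / mu ^+ 3) =
    q%:R ^+ 2 * (2 * mu + q%:R + 1) / (mu ^+ 3 * (mu ^+ 2 - q%:R)).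
    by field; apply/andP; split=> //; rewrite gt_eqF // subr_gt0.
  apply: divr_ge0; apply: mulr_ge0; rewrite ?sqr_ge0 ?exprn_ge0 ?(ltW mu_gt0) //.
    by move: mu_gt0 q_ge1; lra.
  by rewrite subr_ge0 ltW.
by move=> nodis; case: (star_or_triangle q_gt0 sum_degG nodis) => [?|[]//]; left.
Qed.

End Comparison.

Theorem theorem1p6 (R : realType) (n r q : nat)
    (r_ge2 : (2 <= r)%N) (q_ge1 : (1 <= q)%N)
    (q_le : q%:R <= n%:R / (100%:R * r%:R) :> R)
    (V : finType) (G : sgraph V) (GT : turan_plus_edges n r q G) :
  (lambda R (Y_graph n r q) <= lambda R G /\
   (lambda R G = lambda R (Y_graph n r q) <-> graph_iso G (Y_graph n r q))) /\
  (lambda R G <= lambda R (L_graph n r q) /\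
   (lambda R G = lambda R (L_graph n r q) <-> graph_iso G (L_graph n r q))).
Proof.
have qn : (100 * r * q <= n)%N.
  move: q_le; rewrite ler_pdivlMr ?mulr_gt0 ?ltr0n ?(ltnW r_ge2) //.
  by rewrite mulrC -!natrM ler_nat.
have [f [fb fT fq]] := GT.
have sym : symmetric (fun x y => G (f x) (f y)) by move=> x y; rewrite adj_sym.
have irr : irreflexive (fun x y => G (f x) (f y)) by move=> x; rewrite adj_irr.
(* [G] is pulled back to ['I_n], where the parts are the residue classes; both the spectral radius
   and the number of edges are invariant. *)
pose G' := SGraph sym irr.
have iso : graph_iso G' G by exists f.
have eq' : #|edge_set G'| = (#|edge_set (turan n r)| + q)%N.
  by rewrite (card_edge_set_iso iso).
have fT' x y : turan n r x y -> adj G' x y by exact: fT.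
have [Yle Yeq] := Y_graph_extremal R r_ge2 q_ge1 qn (G := G') fT' eq'.
have [Lle Leq] := L_graph_extremal R r_ge2 q_ge1 qn (G := G') fT' eq'.
rewrite -(lambda_graph_iso R iso).
have tr (H : sgraph 'I_n) : (lambda R G' = lambda R H -> graph_iso G' H) ->
    lambda R G' = lambda R H <-> graph_iso G H.
  move=> h; split=> [e|GH]; first exact (graph_iso_trans (graph_iso_sym iso) (h e)).
  exact (lambda_graph_iso R (graph_iso_trans iso GH)).
exact (conj (conj Yle (tr _ Yeq)) (conj Lle (tr _ Leq))).
Qed.
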